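(* Let $\mu$ be a measure of $n$-polynomial growth on $\mathbb{R}^d$. Then there exist positive constants $\alpha,\beta>100$ and a two-sided filtration $\{\Sigma_k : k\in\mathbb{Z}\}$ of atomic $\sigma$-algebras of $\mathrm{supp}(\mu)$ that satisfy the following properties, where $\Pi(\Sigma)$ denotes the set of atoms in the filtration: (i) The $\sigma$-algebras $\Sigma_k$ are increasingly nested, i.e. $\Sigma_k\subset\Sigma_{k+1}$ for all $k\in\mathbb{Z}$. (ii) The union over $k \in \mathbb{Z}$ of the spaces $L_\infty(\mathbb{R}^d,\Sigma_k,\mu)$ is weak-$*$ dense in $L_\infty(\mu)$. (iii) If $Q\in\Pi(\Sigma)$, there exists an $(\alpha,\beta)$-doubling ball $B_Q$ with $B_Q\subset Q\subset 28B_Q$. (iv) If $x\in Q\in\Pi(\Sigma)$ and $R=\bigcap_{S\in\Pi(\Sigma),\, S\supsetneq Q} S$, then $$\int_{\alpha B_R\setminus 56B_Q}\frac{d\mu(y)}{|x-y|^n}\le C,$$ where the constant $C$ depends only on $n,d,\alpha,\beta$, and $B_Q$, $B_R$ are the balls in (iii).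
   Context: $\mu$ is a Radon measure on $\mathbb{R}^d$ of normalized $n$-polynomial growth: $\mu(B(x,r))\le r^n$ for all $x\in\mathbb{R}^d$ and $r>0$, where $n$ is a positive number. For a ball $B=B(x,r)$ and $c>0$, $cB=B(x,cr)$. A ball $B(x,r)$ is $(\alpha,\beta)$-doubling if $\mu(B(x,\alpha r))\le\beta\,\mu(B(x,r))$. Sets are identified with their intersections with $\mathrm{supp}(\mu)$, and relations between sets are understood up to sets of $\mu$-measure $0$. An atom of a $\sigma$-algebra is a measurable set that cannot be decomposed into smaller measurable sets; a $\sigma$-algebra is atomic if it is generated by its atoms, which partition the space. $\Pi(\Sigma)=\bigcup_{k}\Pi(\Sigma_k)$, where $\Pi(\Sigma_k)$ is the set of atoms of $\Sigma_k$. *)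

(* Defs.v *)
From HB Require Import structures.
From mathcomp Require Import all_boot all_order all_algebra.
From mathcomp Require Import all_classical all_reals all_analysis.
Set Implicit Arguments.
Unset Strict Implicit.
Unset Printing Implicit Defensive.
Import Order.TTheory GRing.Theory Num.Theory.
Import numFieldNormedType.Exports.

Local Open Scope classical_set_scope.
Local Open Scope ring_scope.

(* ['rV[R]_d] with its Borel sigma-algebra. *)
Definition Rd (R : realType) (d : nat) : Type :=
  g_sigma_algebraType (@open 'rV[R]_d).
HB.instance Definition _ (R : realType) (d : nat) :=
  Measurable.copy (Rd R d) (g_sigma_algebraType (@open 'rV[R]_d)).

Section space.
Context {R : realType} {d : nat}.

(* The library's norm on ['rV[R]_d] is the sup norm, hence this definition. *)
Definition eucl_dist (x y : 'rV[R]_d) : R :=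
  Num.sqrt (\sum_(i < d) (x ord0 i - y ord0 i) ^+ 2).

Definition eucl_ball (x : 'rV[R]_d) (r : R) : set (Rd R d) :=
  [set y | eucl_dist x y < r].

Variable mu : {measure set (Rd R d) -> \bar R}.

Definition radon : Prop :=
  [/\ forall K : set 'rV[R]_d, compact K -> (mu K < +oo)%E,
      forall A : set (Rd R d), measurable A ->
        mu A = ereal_inf [set mu U | U in
                 [set U : set 'rV[R]_d | open U /\ A `<=` U]]
    & forall U : set 'rV[R]_d, open U ->
        mu U = ereal_sup [set mu K | K in
                 [set K : set 'rV[R]_d | compact K /\ K `<=` U]] ].

Definition polynomial_growth (n : R) : Prop :=
  forall (x : 'rV[R]_d) (r : R), 0 < r -> (mu (eucl_ball x r) <= (r `^ n)%:E)%E.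

Definition supp : set (Rd R d) :=
  [set x | forall r : R, 0 < r -> (0 < mu (eucl_ball x r))%E].

Definition doubling (alpha beta : R) (x : 'rV[R]_d) (r : R) : Prop :=
  (mu (eucl_ball x (alpha * r)) <= beta%:E * mu (eucl_ball x r))%E.

(* Inclusion and strict inclusion up to mu-null sets. As [~` supp] is null,
   replacing a set by its intersection with [supp] changes neither of them. *)
Definition ae_subset (A B : set (Rd R d)) : Prop := mu.-negligible (A `\` B).

Definition ae_proper (A B : set (Rd R d)) : Prop :=
  ae_subset A B /\ ~ ae_subset B A.

Definition sub_sigma_algebra_supp (Sigma : set (set (Rd R d))) : Prop :=
  [/\ sigma_algebra supp Sigma,
      forall A, Sigma A -> A `<=` supp
    & Sigma `<=` measurable].

(* A null set counts as empty, so it is not an atom. *)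
Definition atoms (Sigma : set (set (Rd R d))) : set (set (Rd R d)) :=
  [set Q | [/\ Sigma Q, ~ mu.-negligible Q
     & forall A, Sigma A -> A `<=` Q -> A = set0 \/ A = Q] ].

Definition atomic (Sigma : set (set (Rd R d))) : Prop :=
  [/\ Sigma = <<s supp, atoms Sigma >>,
      trivIset (atoms Sigma) id
    & ae_subset supp (\bigcup_(Q in atoms Sigma) Q)].

Definition filtration_atoms (Sigma : int -> set (set (Rd R d))) :
    set (set (Rd R d)) :=
  \bigcup_k atoms (Sigma k).

(* The intersection is taken inside the ambient space [supp]: it is [supp] when
   no atom is strictly larger than [Q]. *)
Definition parent (Sigma : int -> set (set (Rd R d))) (Q : set (Rd R d)) :
    set (Rd R d) :=
  supp `&` \bigcap_(S in [set S | filtration_atoms Sigma S /\ ae_proper Q S]) S.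

(* Functions rather than classes of functions modulo a.e. equality: the pairing
   below, hence the topology it induces, does not see the difference. *)
Definition L1 : Type := LfunType mu (lexx (1%E : \bar R)).
Definition Linf : Type := LfunType mu (leey (1%E : \bar R)).

Definition pairing (f : Linf) : {ptws L1 -> R} :=
  fun g : L1 => \int[mu]_x (f x * g x).

(* The weak-* topology of [Linf] as the dual of [L1]: the coarsest one making
   [f |-> pairing f g] continuous for every [g] in [L1]. *)
Definition weakstar_Linf : topologicalType := initial_topology pairing.

Definition Linf_sub (Sigma : set (set (Rd R d))) : set weakstar_Linf :=
  [set f : Linf | forall B : set R, measurable B -> Sigma (supp `&` f @^-1` B)].

End space.

Arguments Linf_sub {R d} mu Sigma.

(* Main.v *)
Require Import Defs.
From mathcomp Require Import all_boot all_order all_algebra.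
From mathcomp Require Import all_classical all_reals all_analysis.
From mathcomp Require Import measurable_realfun ess_sup_inf.
From mathcomp Require Import ring lra zify.
Set Implicit Arguments.
Unset Strict Implicit.
Unset Printing Implicit Defensive.
Import Order.TTheory GRing.Theory Num.Theory.
Import numFieldNormedType.Exports.
Local Open Scope classical_set_scope.
Local Open Scope ring_scope.

(** The atoms are doubling cubes of a David-Mattila lattice. At the scale
    [rho k = 200 ^ (-2k)] a point of the support gets the radius [200 * rho k]
    if the corresponding ball is (200, beta)-doubling (a good point) and [rho k]
    otherwise; a maximal family of well separated points at each level, with a
    map sending centers of level [k + 1] to nearby centers of level [k], is a
    tree, whose branches give nested partitions of the support into cubes
    comparable with the chosen balls. If a center is not good, its ball of radius
    [200 * rho k] has at most [1 / beta] times the mass of the dilated ball of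
    its parent. As [beta] exceeds both [200 ^ (2n)] and [200 ^ (2d)], along a
    chain of cubes that are not good the masses decay faster than the scales:
    this bounds the integral between two consecutive good cubes, and shows that
    every point has good cubes of arbitrarily large size and almost every point
    has good cubes of arbitrarily small size. The atoms of [Sigma k] are the
    maximal good cubes of level at least [k]. *)

(** * The Euclidean distance *)

(** Each level tests doubling once, on the ball of radius [200 * rho k]. If the test succeeds, this
    ball is kept. If it fails, the radius drops to [rho k]: then 200 times the new ball is exactly
    the ball found to have small mass, and the larger ball of the failed test has radius
    [200 * 200 * rho k = rho (k - 1)] and lies in 200 times the ball of the parent. This is why
    [alpha] is 200 and the ratio of scales is its square: failures at consecutive levels multiply.
    The factors 2 in the lower bounds on [beta] leave a geometric series to sum. The obstacle is
    that one set can be a cube of many levels (a bounded support is a cube of every coarse level),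
    whereas an atom, its ball and its parent depend on the set alone. The ball is that of one chosen
    level, and the integral estimate must be able to pass between levels with the same cube. *)

Section eucl.
Context {R : realType} {d : nat}.
Implicit Types x y z : 'rV[R]_d.

Lemma sum_sqr_ge0 (a : 'I_d -> R) : 0 <= \sum_(i < d) a i ^+ 2.
Proof. by apply: sumr_ge0 => i _; exact: sqr_ge0. Qed.

(** Lagrange's identity: the double sum of (a_i b_j - a_j b_i)^2 is twice the difference of the two
    sides. *)
Lemma cauchy_schwarz_sum (a b : 'I_d -> R) :
  (\sum_(i < d) a i * b i) ^+ 2 <=
  (\sum_(i < d) a i ^+ 2) * (\sum_(i < d) b i ^+ 2).
Proof.
have : 0 <= \sum_(i < d) \sum_(j < d) (a i * b j - a j * b i) ^+ 2.
  by apply: sumr_ge0 => i _; apply: sumr_ge0 => j _; exact: sqr_ge0.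
set A := \sum_(i < d) a i ^+ 2; set B := \sum_(i < d) b i ^+ 2.
set S := \sum_(i < d) a i * b i.
suff -> : \sum_(i < d) \sum_(j < d) (a i * b j - a j * b i) ^+ 2 =
    2 * (A * B - S ^+ 2) by lra.
transitivity (\sum_(i < d) (a i ^+ 2 * B + b i ^+ 2 * A - 2 * (a i * b i) * S)).
  apply: eq_bigr => i _; rewrite /A /B /S !mulr_sumr -big_split/= -sumrB.
  by apply: eq_bigr => j _; ring.
rewrite sumrB big_split/= -!mulr_suml -mulr_sumr -/A -/B -/S; ring.
Qed.

Lemma eucl_dist_ge0 x y : 0 <= eucl_dist x y.
Proof. exact: sqrtr_ge0. Qed.

Lemma eucl_distxx x : eucl_dist x x = 0.
Proof.
rewrite /eucl_dist big1 ?sqrtr0// => i _.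
by rewrite subrr expr0n.
Qed.

Lemma eucl_distC x y : eucl_dist x y = eucl_dist y x.
Proof.
by congr Num.sqrt; apply: eq_bigr => i _; rewrite -sqrrN opprB.
Qed.

Lemma eucl_dist_triangle y x z :
  eucl_dist x z <= eucl_dist x y + eucl_dist y z.
Proof.
rewrite -[leRHS]ger0_norm ?addr_ge0 ?eucl_dist_ge0// -sqrtr_sqr.
rewrite ler_sqrt ?sqr_ge0// sqrrD !sqr_sqrtr ?sum_sqr_ge0//.
have -> : \sum_(i < d) (x ord0 i - z ord0 i) ^+ 2 =
    \sum_(i < d) (x ord0 i - y ord0 i) ^+ 2 +
    2 * (\sum_(i < d) (x ord0 i - y ord0 i) * (y ord0 i - z ord0 i)) +
    \sum_(i < d) (y ord0 i - z ord0 i) ^+ 2.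
  by rewrite mulr_sumr -!big_split/=; apply: eq_bigr => i _; ring.
rewrite lerD2r lerD2l -[leRHS]mulr_natl ler_pM2l// /eucl_dist.
rewrite -sqrtrM ?sum_sqr_ge0//.
apply: le_trans (ler_norm _) _; rewrite -sqrtr_sqr ler_sqrt.
  exact: cauchy_schwarz_sum.
by rewrite mulr_ge0 ?sum_sqr_ge0.
Qed.

Lemma coord_le_eucl_dist x y i : `|x ord0 i - y ord0 i| <= eucl_dist x y.
Proof.
rewrite -sqrtr_sqr ler_sqrt ?sum_sqr_ge0// (bigD1 i)//= lerDl.
by apply: sumr_ge0 => j _; exact: sqr_ge0.
Qed.

(** The factor [d.+1], cruder than the square root of [d], keeps the inequality strict in dimension
    0. *)
Lemma eucl_dist_lt_coord x y e : 0 < e ->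
  (forall i, `|x ord0 i - y ord0 i| < e) -> eucl_dist x y < d.+1%:R * e.
Proof.
move=> e0 h; rewrite -[ltRHS]gtr0_norm ?mulr_gt0// -sqrtr_sqr.
rewrite ltr_sqrt ?exprn_gt0 ?mulr_gt0// exprMn.
apply: (@le_lt_trans _ _ (\sum_(i < d) e ^+ 2)).
  apply: ler_sum => i _; rewrite -[leLHS]real_normK ?num_real//.
  by apply: lerXn2r; rewrite ?nnegrE ?normr_ge0//; [exact: ltW|exact/ltW/h].
rewrite sumr_const card_ord -[ltLHS]mulr_natl ltr_pM2r ?exprn_gt0//.
by rewrite -natrX ltr_nat; apply: (@leq_trans d.+1) => //; rewrite expnS expn1 leq_pmulr.
Qed.

Lemma nbhs_eucl_ball x e : 0 < e -> nbhs x (eucl_ball x e : set 'rV[R]_d).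
Proof.
move=> e0; apply/nbhs_ballP; exists (e / d.+1%:R); first by rewrite /= divr_gt0.
move=> y xy; have /eucl_dist_lt_coord : 0 < e / d.+1%:R by rewrite divr_gt0.
move=> /(_ x y); rewrite mulrCA divff// mulr1; apply => i.
exact: (xy.2 ord0 i).
Qed.

Lemma open_euclP (U : set 'rV[R]_d) : open U <->
  (forall x, U x -> exists2 e, 0 < e & eucl_ball x e `<=` U).
Proof.
split=> [oU x Ux|h].
  have /nbhs_ballP[e /= e0 he] : nbhs x U by apply: open_nbhs_nbhs.
  exists e => // y xy; apply: he; split=> // i j; rewrite ord1 /ball/=.
  by apply: le_lt_trans (coord_le_eucl_dist _ _ _) xy.
rewrite openE => x /h[e e0 he]; rewrite /interior.
apply: filterS he _; exact: nbhs_eucl_ball.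
Qed.

Lemma open_eucl_ball x r : open (eucl_ball x r : set 'rV[R]_d).
Proof.
apply/open_euclP => y xy; exists (r - eucl_dist x y); first by rewrite subr_gt0.
move=> z; rewrite /eucl_ball/= => yz.
by apply: le_lt_trans (eucl_dist_triangle y _ _) _; rewrite addrC -ltrBrDr.
Qed.

Lemma open_measurable_Rd (U : set 'rV[R]_d) : open U -> measurable (U : set (Rd R d)).
Proof. exact: sub_sigma_algebra. Qed.

Lemma closed_measurable_Rd (U : set 'rV[R]_d) : closed U -> measurable (U : set (Rd R d)).
Proof.
move=> /closed_openC/open_measurable_Rd/measurableC.
by rewrite setCK.
Qed.

Lemma measurable_eucl_ball x r : measurable (eucl_ball x r).
Proof. by apply: open_measurable_Rd; exact: open_eucl_ball. Qed.

Lemma measurable_eucl_dist x :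
  measurable_fun setT (eucl_dist x : Rd R d -> R).
Proof.
apply: (measurability (@RGenCInfty.G R)) => [|/= _ [_] [a] -> <-].
  exact: RGenCInfty.measurableE.
rewrite setTI.
have -> : eucl_dist x @^-1` `[a, +oo[%classic = ~` eucl_ball x a.
  apply/seteqP; split=> y; rewrite /eucl_ball/= in_itv/= andbT leNgt; first by move/negP.
  by move=> /negP.
by apply: measurableC; exact: measurable_eucl_ball.
Qed.

Lemma subset_eucl_ball x y r s : eucl_dist x y + r <= s ->
  eucl_ball y r `<=` eucl_ball x s.
Proof.
move=> h z; rewrite /eucl_ball/= => yz; apply: le_lt_trans (eucl_dist_triangle y _ _) _.
by apply: lt_le_trans h; rewrite ltrD2l.
Qed.

End eucl.

(** * Grids and separated sets *)

(** Stated for an arbitrary class [S], as it serves for measurable sets, for null sets and for the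
    sigma-algebras of the filtration. *)
Lemma bigcup_countable_closed {T I : Type} (S : set (set T)) (D : set I)
    (F : I -> set T) :
  S set0 -> (forall G : nat -> set T, (forall n, S (G n)) -> S (\bigcup_n G n)) ->
  countable D -> (forall i, D i -> S (F i)) -> S (\bigcup_(i in D) F i).
Proof.
move=> S0 Sbig /countable_injP[f finj] SF.
have -> : \bigcup_(i in D) F i = \bigcup_n \bigcup_(i in [set i | D i /\ f i = n]) F i.
  apply/seteqP; split=> [x [i Di Fx]|x [n _ [i [Di _] Fx]]]; last by exists i.
  by exists (f i) => //; exists i.
apply: Sbig => n.
have [[i [Di fin]]|h] := pselect (exists i, D i /\ f i = n); last first.
  rewrite bigcup0// => i Hi; exfalso; apply: h; by exists i.
suff -> : \bigcup_(i0 in [set i0 | D i0 /\ f i0 = n]) F i0 = F i by exact: SF.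
apply/seteqP; split=> [x [j [Dj fj] Fx]|x Fx]; last by exists i.
by rewrite (_ : i = j)//; apply: finj; rewrite ?inE// fin fj.
Qed.

Section grid.
Context {R : realType} {d : nat}.
Implicit Types x y z : 'rV[R]_d.

Definition box (M : R) : set 'rV[R]_d := [set x | forall i, `|x ord0 i| <= M].

(** Index of the grid cell of mesh [e] containing [x]. It is meaningful on [box M] when 2M <= eN;
    [inord] makes it total. *)
Definition cell (M e : R) (N : nat) x : {ffun 'I_d -> 'I_N.+1} :=
  [ffun i => inord (Num.truncn ((x ord0 i + M) / e))].

Lemma cell_inj (M e : R) N x y : 0 < e -> M + M <= e * N%:R -> box M x -> box M y ->
  cell M e N x = cell M e N y -> eucl_dist x y < d.+1%:R * e.
Proof.
move=> e0 MN bx yb xy; apply: eucl_dist_lt_coord => // i.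
have /(congr1 val) : cell M e N x i = cell M e N y i by rewrite xy.
rewrite !ffunE/=.
have key z : box M z -> 0 <= (z ord0 i + M) / e /\
    (Num.truncn ((z ord0 i + M) / e) < N.+1)%N.
  move=> /(_ i); rewrite ler_norml => /andP[z1 z2].
  have zM0 : 0 <= z ord0 i + M by lra.
  have z0 : 0 <= (z ord0 i + M) / e by rewrite divr_ge0// ltW.
  split=> //; rewrite truncn_lt_nat// ltr_pdivrMr//.
  apply: (@le_lt_trans _ _ (M + M)); first by rewrite lerD2r.
  by apply: le_lt_trans MN _; rewrite mulrC ltr_pM2r// ltr_nat.
have [x0 xN] := key x bx; have [y0 yN] := key y yb.
rewrite !inordK// => h.
have /andP[x1 x2] := truncn_itv x0; have /andP[y1 y2] := truncn_itv y0.
rewrite h in x1 x2.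
have : `|(x ord0 i + M) / e - (y ord0 i + M) / e| < 1.
  by rewrite ltr_norml -natr1 in x2 y2 *; apply/andP; split; lra.
rewrite -mulrBl normrM [`|e^-1|]gtr0_norm ?invr_gt0// ltr_pdivrMr// mul1r.
by rewrite opprD addrACA subrr addr0.
Qed.

Lemma cell_bound (M e : R) : 0 < e -> exists N : nat, M + M <= e * N%:R.
Proof.
move=> e0; exists (Num.truncn ((M + M) / e)).+1.
by rewrite mulrC -ler_pdivrMr// ltW// real_truncnS_gt ?num_real.
Qed.

Definition separated (e : R) (A : set 'rV[R]_d) :=
  forall x y, A x -> A y -> x != y -> e <= eucl_dist x y.

(** At mesh e / (d + 1) two points of one cell are closer than [e], so each cell contains at most
    one point of [A]. *)
Lemma separated_finite (e : R) A M : 0 < e -> separated e A -> finite_set (A `&` box M).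
Proof.
move=> e0 sA; have e'0 : 0 < e / d.+1%:R by rewrite divr_gt0.
have [N MN] := cell_bound M e'0.
have inj : {in A `&` box M &, injective (cell M (e / d.+1%:R) N)}.
  move=> x y; rewrite !inE => -[Ax bx] [Ay yb] /(cell_inj e'0 MN bx yb).
  rewrite mulrCA divff// mulr1 => xy; apply/eqP; apply: contraPP xy => /negP nxy.
  by apply/negP; rewrite -leNgt; exact: sA.
by rewrite -(eq_finite_set (inj_card_eq inj)); exact: finite_finset.
Qed.

Lemma eucl_ball_box x r : exists M, eucl_ball x r `<=` box M.
Proof.
exists (eucl_dist 0 x + r) => y xy i.
have := coord_le_eucl_dist y 0 i; rewrite mxE subr0 => /le_trans; apply.
rewrite eucl_distC; apply: le_trans (eucl_dist_triangle x _ _) _.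
by rewrite lerD2l ltW.
Qed.

Lemma separated_finite_ball e A x r : 0 < e -> separated e A ->
  finite_set (A `&` eucl_ball x r).
Proof.
move=> e0 sA; have [M xM] := eucl_ball_box x r.
apply: sub_finite_set (separated_finite M e0 sA).
by apply: setIS.
Qed.

Lemma bigcup_ball x : \bigcup_(n in [set: nat]) eucl_ball x n%:R = setT :> set 'rV[R]_d.
Proof.
apply/seteqP; split=> // y _; exists (Num.truncn (eucl_dist x y)).+1 => //.
by rewrite /eucl_ball/= real_truncnS_gt ?num_real.
Qed.

Lemma separated_countable e A : 0 < e -> separated e A -> countable A.
Proof.
move=> e0 sA; rewrite -[A]setIT -(bigcup_ball 0) setI_bigcupr.
apply: bigcup_countable => // n _; apply: finite_set_countable.
exact: separated_finite_ball sA.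
Qed.

Lemma maximal_separated (G : set 'rV[R]_d) e : 0 < e ->
  exists A, [/\ A `<=` G, separated e A &
    forall x, G x -> exists2 a, A a & eucl_dist x a < e].
Proof.
move=> e0; have [F FP Ftot|A [[AG sA] Amax]] :=
  @Zorn_bigcup _ [set A | A `<=` G /\ separated e A].
  split=> [x [A /FP[AG _]]|x y [A FA Ax] [B FB By]]; first exact: AG.
  have [AB|BA] := Ftot _ _ FA FB.
    by have [_] := FP _ FB; apply => //; exact: AB.
  by have [_] := FP _ FA; apply => //; exact: BA.
exists A; split=> // x Gx; apply: contrapT => h.
have far a : A a -> e <= eucl_dist x a.
  by move=> Aa; rewrite leNgt; apply/negP => xa; apply: h; exists a.
apply: (Amax (A `|` [set x])).
  split; first by left.
  move=> /(_ x) Ax; have {}Ax : A x by apply: Ax; right.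
  by have := far _ Ax; rewrite eucl_distxx leNgt e0.
split=> [y [/AG//|->//]|y z [Ay|->] [Az|->]].
- exact: sA.
- by rewrite eucl_distC => _; exact: far.
- by move=> _; exact: far.
- by rewrite eqxx.
Qed.

End grid.

(** * Trees of centers *)

Section scales.
Context {R : realType}.

(* Locked, lest conversion compute with this numeral in unary. *)
Fact ratio_key : unit. Proof. exact: tt. Qed.
Definition ratio : R := locked_with ratio_key (200 * 200).

Lemma ratioE : ratio = 200 * 200.
Proof. by rewrite /ratio unlock. Qed.

Lemma ratio_gt1 : 1 < ratio.
Proof. by rewrite ratioE; lra. Qed.

Lemma ratio_gt0 : 0 < ratio.
Proof. exact: lt_trans ratio_gt1. Qed.

Lemma ratio_neq0 : ratio != 0.
Proof. by rewrite gt_eqF// ratio_gt0. Qed.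

Definition rho (k : int) : R := ratio ^ (- k).

Lemma rho_gt0 k : 0 < rho k.
Proof. by rewrite /rho exprz_gt0// ratio_gt0. Qed.

Lemma rho_ratio k : rho k = ratio * rho (k + 1).
Proof.
by rewrite /rho opprD expfzDr ?ratio_neq0// exprN1 mulrCA divff ?ratio_neq0// mulr1.
Qed.

Lemma rhoS k : rho k = 200 * (200 * rho (k + 1)).
Proof. by rewrite rho_ratio ratioE -mulrA. Qed.

Lemma rho_add k (s : nat) : rho (k + s%:Z) = rho k / ratio ^+ s.
Proof. by rewrite /rho opprD expfzDr ?ratio_neq0// exprnN. Qed.

Lemma rho_sub k (s : nat) : rho (k - s%:Z) = rho k * ratio ^+ s.
Proof. by rewrite /rho opprB addrC expfzDr ?ratio_neq0. Qed.

Lemma le_rho k m : k <= m -> rho m <= rho k.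
Proof.
move=> km; have -> : m = k + (`|m - k|%N)%:Z by lia.
rewrite rho_add ler_pdivrMr ?exprn_gt0 ?ratio_gt0// ler_peMr ?(ltW (rho_gt0 _))//.
by rewrite exprn_ege1// ltW// ratio_gt1.
Qed.

Lemma pow_gt_nat (n : nat) : n%:R < ratio ^+ n :> R.
Proof.
apply: (@lt_le_trans _ _ (2 ^+ n)); first by rewrite -natrX ltr_nat ltn_expl.
by apply: lerXn2r; rewrite ?nnegrE ?ratioE; lra.
Qed.

Lemma rho_small (e : R) : 0 < e -> exists M : int, forall m, M <= m -> rho m < e.
Proof.
move=> e0; pose n := (Num.truncn e^-1).+1; exists n%:Z => m nm.
apply: le_lt_trans (le_rho nm) _; rewrite -[n%:Z]add0r rho_add.
rewrite ltr_pdivrMr ?exprn_gt0 ?ratio_gt0// /rho oppr0 expr0z -ltr_pdivrMl// mulr1.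
by apply: lt_trans (pow_gt_nat _); rewrite /n real_truncnS_gt ?num_real.
Qed.

Lemma rho_large (e : R) : exists M : int, forall m, m <= M -> e < rho m.
Proof.
pose n := (Num.truncn e).+1; exists (- n%:Z) => m nm.
apply: lt_le_trans (le_rho nm); rewrite -[- n%:Z]add0r rho_sub.
rewrite /rho oppr0 expr0z mul1r.
by apply: lt_trans (pow_gt_nat _); rewrite /n real_truncnS_gt ?num_real.
Qed.

End scales.

Section centers.
Context {R : realType} {d : nat}.
Variables (S : set 'rV[R]_d) (good : int -> 'rV[R]_d -> Prop).
Implicit Types (x y v w : 'rV[R]_d) (k m : int).

Definition rad k x : R := if `[< good k x >] then 200 * rho k else rho k.

Lemma rad_ge k x : rho k <= rad k x.
Proof. by rewrite /rad; case: asboolP => _ //; have := @rho_gt0 R k; lra. Qed.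

Lemma rad_le k x : rad k x <= 200 * rho k.
Proof. by rewrite /rad; case: asboolP => _ //; have := @rho_gt0 R k; lra. Qed.

Lemma rad_good k x : good k x -> rad k x = 200 * rho k.
Proof. by rewrite /rad => h; case: asboolP. Qed.

Lemma rad_bad k x : ~ good k x -> rad k x = rho k.
Proof. by rewrite /rad => h; case: asboolP. Qed.

Lemma rad_gt0 k x : 0 < rad k x.
Proof. exact: lt_le_trans (rho_gt0 k) (rad_ge k x). Qed.

(** As in Vitali's covering lemma, the large radii come first: a maximal separated set of good
    points, then one of the points that are not good and are far from those already chosen. Hence
    the separation involves the larger of the two radii. *)
Lemma exists_centers k : exists Z : set 'rV[R]_d, [/\ Z `<=` S,
  forall v w, Z v -> Z w -> v != w -> 4 * rad k v <= eucl_dist v w &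
  forall x, S x -> exists2 w, Z w & eucl_dist x w < 4 * rad k w].
Proof.
have r0 := @rho_gt0 R k.
have [|A [AG sA Amax]] := @maximal_separated R d (S `&` good k) (4 * (200 * rho k)).
  by lra.
have [|B [BG sB Bmax]] := @maximal_separated R d
    (S `&` [set x | ~ good k x /\ forall a, A a -> 4 * (200 * rho k) <= eucl_dist x a])
    (4 * rho k); first by lra.
exists (A `|` B); split.
- by move=> x [/AG[]|/BG[]].
- move=> v w [Av|Bv] [Aw|Bw] vw.
  + by rewrite rad_good; [exact: sA|exact: (AG _ Av).2].
  + rewrite rad_good; last exact: (AG _ Av).2.
    by rewrite eucl_distC; apply: (BG _ Bw).2.2.
  + apply: le_trans ((BG _ Bv).2.2 _ Aw).
    by rewrite ler_pM2l// rad_le.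
  + by rewrite rad_bad; [exact: sB|exact: (BG _ Bv).2.1].
- move=> x Sx; have [gx|bx] := pselect (good k x).
    have [a Aa xa] := Amax x (conj Sx gx); exists a; first by left.
    by rewrite rad_good//; exact: (AG _ Aa).2.
  have [[a [Aa xa]]|h] := pselect (exists a, A a /\ eucl_dist x a < 4 * (200 * rho k)).
    exists a; first by left.
    by rewrite rad_good//; exact: (AG _ Aa).2.
  have [|b Bb xb] := Bmax x.
    split=> //; split=> // a Aa; rewrite leNgt; apply/negP => xa.
    by apply: h; exists a.
  exists b; first by right.
  by rewrite rad_bad//; exact: (BG _ Bb).2.1.
Qed.

Variable Z : int -> set 'rV[R]_d.
Hypothesis ZS : forall k, Z k `<=` S.
Hypothesis Zsep : forall k v w, Z k v -> Z k w -> v != w ->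
  4 * rad k v <= eucl_dist v w.
Hypothesis Zcov : forall k x, S x ->
  exists2 w, Z k w & eucl_dist x w < 4 * rad k w.

Lemma centers_separated k : separated (4 * rho k) (Z k).
Proof.
move=> v w Zv Zw vw; apply: le_trans (Zsep Zv Zw vw).
by rewrite ler_pM2l// rad_ge.
Qed.

Lemma rho4_gt0 k : 0 < 4 * rho k :> R.
Proof. by rewrite mulr_gt0// rho_gt0. Qed.

(** Separation makes the balls of radius [2 * rad k u] disjoint, so the last clause prescribes at
    most one center. It keeps descendants lying near [u] below [u]; this is what puts the ball of
    radius [rad k u] into the cube of [u]. *)
Lemma exists_parent k v : S v -> exists w, [/\ Z k w,
  eucl_dist v w < 4 * rad k w &
  forall u, Z k u -> eucl_dist v u < 2 * rad k u -> w = u].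
Proof.
move=> Sv; have [[u [Zu vu]]|h] := pselect (exists u, Z k u /\ eucl_dist v u < 2 * rad k u).
  have ru := rad_gt0 k u.
  exists u; split=> //; first by lra.
  move=> w Zw vw; apply/eqP; apply: contrapT => /negP uw.
  have h1 := Zsep Zu Zw uw; have h2 : 4 * rad k w <= eucl_dist w u.
    by apply: Zsep => //; rewrite eq_sym.
  have := eucl_dist_triangle v u w; rewrite (eucl_distC u v).
  by rewrite eucl_distC in h2; lra.
have [w Zw vw] := Zcov k Sv; exists w; split=> // u Zu vu.
by exfalso; apply: h; exists u.
Qed.

Variable par : int -> 'rV[R]_d -> 'rV[R]_d.
Hypothesis parZ : forall k v, S v -> Z k (par k v).
Hypothesis par_dist : forall k v, S v ->
  eucl_dist v (par k v) < 4 * rad k (par k v).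
Hypothesis par_near : forall k v u, S v -> Z k u ->
  eucl_dist v u < 2 * rad k u -> par k v = u.

(* [desc k w m v]: the center [w] of level [k] is the ancestor of the center [v]
   of level [m]. *)
Inductive desc : int -> 'rV[R]_d -> int -> 'rV[R]_d -> Prop :=
| desc_refl k w : Z k w -> desc k w k w
| desc_step k w m v : Z (k + 1) w -> desc (k + 1) w m v -> desc k (par k w) m v.

Lemma desc_inv k w m v : desc k w m v -> Z m v /\ (w = v \/
  exists w', [/\ Z (k + 1) w', par k w' = w & desc (k + 1) w' m v]).
Proof.
have Zm : desc k w m v -> Z m v by elim.
move=> h; split; first exact: Zm.
by case: h => {k w m v Zm} [|k w m v Zw wv]; [left|right; exists w].
Qed.

Lemma desc_src k w m v : desc k w m v -> Z k w.
Proof. by case=> // {}k {}w {}m {}v /ZS/parZ. Qed.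

(** The step from level [k + 1] to [k] costs [4 * rad k w]; all finer steps together cost at most
    [5 * (200 * rho (k + 1))], which is [rho k / 40]. *)
Lemma desc_dist k w m v : desc k w m v -> eucl_dist w v < 5 * rad k w.
Proof.
elim=> {k w m v} [k w _|k w m v Zw _ ih].
  by rewrite eucl_distxx mulr_gt0// rad_gt0.
have /par_dist-/(_ k) := ZS Zw; have := eucl_dist_triangle w (par k w) v.
rewrite (eucl_distC (par k w) w).
have := rad_le (k + 1) w; have := rad_ge k (par k w); have := rhoS (R := R) k.
by have := @rho_gt0 R k; lra.
Qed.

Lemma desc_exists m v k : Z m v -> k <= m -> exists2 w, Z k w & desc k w m v.
Proof.
move=> Zv km; have -> : k = m - (`|m - k|%N)%:Z by lia.
elim: `|m - k|%N => [|s [w Zw ih]]; first by rewrite subr0; exists v => //; exact: desc_refl.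
have e : m - s%:Z = m - s.+1%:Z + 1 by lia.
rewrite {}e in Zw ih; exists (par (m - s.+1%:Z) w); last exact: desc_step.
exact/parZ/(ZS Zw).
Qed.

(* These closed sets cover the support and overlap only at the boundaries of
   cubes. *)
Definition reach k w : set 'rV[R]_d := [set x | forall (M : int) (e : R), 0 < e ->
  exists m v, [/\ M <= m, desc k w m v & eucl_dist x v < e]].

Lemma closed_reach k w : closed (reach k w).
Proof.
rewrite -[reach k w]setCK; apply: open_closedC; apply/open_euclP => x Tx.
have [M [e [e0 h]]] : exists M e, 0 < e /\ forall m v, M <= m -> desc k w m v -> e <= eucl_dist x v.
  apply: contrapT => h; apply: Tx => M e e0; apply: contrapT => h'.
  apply: h; exists M, e; split=> // m v Mm kwmv; rewrite leNgt; apply/negP => xv.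
  by apply: h'; exists m, v.
exists (e / 2); first by rewrite divr_gt0.
move=> y xy /(_ M (e / 2)); rewrite divr_gt0// => /(_ isT)[m [v [Mm kwmv yv]]].
have := h _ _ Mm kwmv; have := eucl_dist_triangle y x v.
by move: xy; rewrite /eucl_ball/=; lra.
Qed.

Lemma reach_par k w : Z (k + 1) w -> reach (k + 1) w `<=` reach k (par k w).
Proof.
move=> Zw x h M e /(h M)[m [v [Mm kwmv xv]]].
by exists m, v; split=> //; exact: desc_step.
Qed.

Lemma reach_dist k w x : reach k w x -> eucl_dist x w < 6 * rad k w.
Proof.
have r0 := rad_gt0 k w; move=> /(_ k _ r0)[m [v [_ /desc_dist + xv]]].
by have := eucl_dist_triangle v x w; rewrite (eucl_distC v w); lra.
Qed.

(** A descendant of [w] close to [x] has its ancestor of level [k + 1] within [rho k / 40], hence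
    within [2 * rad k u] of [u]: the parent of that ancestor is [u]. *)
Lemma reach_near k w u x : Z k u -> eucl_dist x u < rad k u -> reach k w x -> w = u.
Proof.
have r0 : 0 < rho k / 2 :> R by rewrite divr_gt0// rho_gt0.
move=> Zu xu /(_ k (rho k / 2) r0)[m [v [_ + xv]]].
have ru := rad_ge k u.
move=> kwmv; have [_ [wv|[w' [Zw' <- /desc_dist w'v]]]] := desc_inv kwmv.
  have Zw := desc_src kwmv.
  apply/eqP; apply: contrapT => /negP wu.
  have := Zsep Zu Zw; rewrite eq_sym => /(_ wu).
  have := eucl_dist_triangle x u w.
  by rewrite (eucl_distC u x) wv; lra.
apply: par_near => //; first exact: ZS Zw'.
have := eucl_dist_triangle x w' u; have := eucl_dist_triangle v w' x.
rewrite (eucl_distC v x).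
by have := rad_le (k + 1) w'; have := rhoS (R := R) k; lra.
Qed.

(* The induction step of Koenig's lemma. *)
Lemma reach_pigeonhole k (F : set 'rV[R]_d) x : finite_set F ->
  (forall M e, 0 < e -> exists m v w,
    [/\ F w, M <= m, desc k w m v & eucl_dist x v < e]) ->
  exists2 w, F w & reach k w x.
Proof.
move=> /finite_seqP[s ->] h; apply: contrapT => no.
have {no} : forall w, w \in s -> exists M e, 0 < e /\
    forall m v, M <= m -> desc k w m v -> e <= eucl_dist x v.
  move=> w ws; apply: contrapT => h'; apply: no; exists w => // M e e0.
  apply: contrapT => h2; apply: h'; exists M, e; split=> // m v Mm kwmv.
  by rewrite leNgt; apply/negP => xv; apply: h2; exists m, v.
move=> h2; have [M [e [e0 h3]]] : exists M e, 0 < e /\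
    forall w m v, w \in s -> M <= m -> desc k w m v -> e <= eucl_dist x v.
  elim: s h2 {h} => [|w s ih] h2; first by exists 0, 1; split.
  have [|M [e [e0 h3]]] := ih; first by move=> w' ws; apply: h2; rewrite in_cons ws orbT.
  have [|M' [e' [e'0 h4]]] := h2 w; first by rewrite mem_head.
  exists (Num.max M M'), (Num.min e e'); split; first by rewrite lt_min e0.
  move=> w' m v; rewrite in_cons ge_max => /orP[/eqP->|ws] /andP[Mm M'm] kwmv; rewrite ge_min.
    by rewrite (h4 m v)// orbT.
  by rewrite (h3 w' m v).
have [m [v [w [ws Mm kwmv xv]]]] := h M e e0.
by have := h3 _ _ _ ws Mm kwmv; lra.
Qed.

Lemma desc_close k x (M : int) (e : R) : S x -> 0 < e -> exists m v,
  [/\ M <= m, k < m, Z m v & eucl_dist x v < e].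
Proof.
move=> Sx e0; have [N hN] : exists N : int, forall m, N <= m -> rho m < e / 4 / 200.
  by apply: rho_small; lra.
pose m := Num.max (Num.max N M) (k + 1).
have [Nm Mm km] : [/\ N <= m, M <= m & k < m] by split; rewrite /m; lia.
have [w Zw xw] := Zcov m Sx; exists m, w; split=> //.
apply: lt_le_trans xw _; have := rad_le m w; have := hN m Nm.
by lra.
Qed.

Lemma reach_root k x : S x -> exists2 w, Z k w & reach k w x.
Proof.
move=> Sx.
(* The radius is [5 * (200 * rho k)] from [desc_dist], plus [rho k] from the descendant to [x]. *)
have [||w [Zw _] xw] := @reach_pigeonhole k (Z k `&` eucl_ball x (1001 * rho k)) x.
- by apply: separated_finite_ball (@centers_separated k); exact: rho4_gt0.
- move=> M e e0; have r0 := @rho_gt0 R k.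
  have e'0 : 0 < Num.min e (rho k) by rewrite lt_min e0.
  have [m [v [Mm km Zv]]] := desc_close k M Sx e'0.
  rewrite lt_min => /andP[xv xv'].
  have [w Zw kwmv] := desc_exists Zv (ltW km); exists m, v, w; split=> //; split=> //.
  have := desc_dist kwmv; have := rad_le k w; have := eucl_dist_triangle v x w.
  by rewrite /eucl_ball/= (eucl_distC v w); lra.
by exists w.
Qed.

Lemma reach_child k w x : S x -> Z k w -> reach k w x ->
  exists v, [/\ Z (k + 1) v, par k v = w & reach (k + 1) v x].
Proof.
move=> Sx Zw wx.
have [||v [[Zv _] pv] vx] := @reach_pigeonhole (k + 1)
    ((Z (k + 1) `&` eucl_ball w (4 * rad k w)) `&` [set v | par k v = w]) x.
- by apply: finite_setIl; apply: separated_finite_ball (@centers_separated _); exact: rho4_gt0.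
- move=> M e e0.
  have e'0 : 0 < e / 2 by lra.
  have [m [v [Mm + xv]]] := wx M _ e'0.
  move=> /desc_inv[_ [wv|[w' [Zw' pw' w'v']]]].
    (* Here the point close to [x] is [w] itself and may have no ancestor at level [k + 1]. A center
       of a finer level near [w] replaces it; its ancestor is close enough to [w] to be a child of
       [w]. *)
    pose e1 := Num.min (e / 2) (rho k).
    have e10 : 0 < e1 by rewrite lt_min e'0 rho_gt0.
    have [m' [v' [Mm' km Zv]]] := desc_close k M (ZS Zw) e10.
    rewrite lt_min => /andP[xv1 xv2].
    have [|u Zu uv] := @desc_exists _ _ (k + 1) Zv; first by lia.
    have uw : eucl_dist u w < 2 * rad k w.
      have := desc_dist uv; have := eucl_dist_triangle v' u w.
      rewrite (eucl_distC v' w).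
      have := rad_le (k + 1) u; have := rhoS (R := R) k; have := rad_ge k w.
      by have := @rho_gt0 R k; lra.
    exists m', v', u; split=> //; last first.
      by have := eucl_dist_triangle w x v'; rewrite wv in xv1 *; lra.
    split; last by apply: par_near => //; exact: ZS Zu.
    split=> //; rewrite /eucl_ball/= eucl_distC.
    by have := rad_gt0 k w; lra.
  exists m, v, w'; split=> //; last by lra.
  split=> //; split=> //; rewrite /eucl_ball/= eucl_distC -pw'.
  by apply: par_dist; exact: ZS Zw'.
- by exists v.
Qed.

End centers.

(** * Measurable nested labels *)

Section labels.
Context {R : realType} {d : nat}.
Variables (S : set 'rV[R]_d) (good : int -> 'rV[R]_d -> Prop).
Implicit Types (x y v w : 'rV[R]_d) (k m : int).
Variables (Z : int -> set 'rV[R]_d) (par : int -> 'rV[R]_d -> 'rV[R]_d).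
Variable num : int -> 'rV[R]_d -> nat.
Hypothesis num_inj : forall k, {in Z k &, injective (num k)}.

Definition least k (P : set 'rV[R]_d) : set 'rV[R]_d :=
  [set w | [/\ Z k w, P w & forall v, Z k v -> P v -> (num k w <= num k v)%N]].

Lemma least_exists k (P : set 'rV[R]_d) : Z k `&` P !=set0 -> least k P !=set0.
Proof.
move=> [w0 [Zw0 Pw0]].
have ex : exists n, `[< exists w, [/\ Z k w, P w & num k w = n] >].
  by exists (num k w0); apply/asboolP; exists w0.
have [n /asboolP[w [Zw Pw <-]] nmin] := ex_minnP ex.
exists w; split=> // v Zv Pv; apply: nmin; apply/asboolP; by exists v.
Qed.

Lemma least_uniq k (P : set 'rV[R]_d) v w : least k P v -> least k P w -> v = w.
Proof.
move=> [Zv Pv hv] [Zw Pw hw]; apply: (@num_inj k); rewrite ?inE//.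
by apply/eqP; rewrite eqn_leq hv// hw.
Qed.

(* The labels of a point form a branch of the tree: downwards from level 0, each
   one is the first child whose limit set contains the point (so that cubes are
   differences of closed sets, hence measurable); upwards, they are ancestors. *)
Fixpoint label_fine (n : nat) x : 'rV[R]_d :=
  match n with
  | 0%N => xget 0 (least 0 [set w | reach Z par 0 w x])
  | n'.+1 => xget 0 (least n'.+1 [set w | par n' w = label_fine n' x /\
                                          reach Z par n'.+1 w x])
  end.

Fixpoint label_coarse (n : nat) x : 'rV[R]_d :=
  match n with
  | 0%N => par (Negz 0) (label_fine 0 x)
  | n'.+1 => par (Negz n'.+1) (label_coarse n' x)
  end.

Definition label k x : 'rV[R]_d :=
  match k with Posz n => label_fine n x | Negz n => label_coarse n x end.

Hypothesis ZS : forall k, Z k `<=` S.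
Hypothesis reach_root : forall x, S x -> exists2 w, Z 0 w & reach Z par 0 w x.
Hypothesis reach_child : forall k w x, S x -> Z k w -> reach Z par k w x ->
  exists v, [/\ Z (k + 1) v, par k v = w & reach Z par (k + 1) v x].
Hypothesis parZ : forall k v, S v -> Z k (par k v).

Lemma label_fine_spec (n : nat) x : S x ->
  Z n (label_fine n x) /\ reach Z par n (label_fine n x) x.
Proof.
move=> Sx; elim: n => [|n [Zn rn]] /=.
  have [w Zw wx] := reach_root Sx.
  have [|v lv] := @least_exists 0 [set w | reach Z par 0 w x]; first by exists w.
  by case: xgetP => [u _ [Zu ux _]//|/(_ v)].
have [v [Zv pv vx]] := reach_child Sx Zn rn.
have en : n%:Z + 1 = n.+1 by lia.
rewrite en in Zv vx.
have [|u lu] := @least_exists n.+1 [set w | par n w = label_fine n x /\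
                                          reach Z par n.+1 w x]; first by exists v.
by case: xgetP => [u' _ [Zu [_ ux] _]//|/(_ u)].
Qed.

Lemma label_fine_least (n : nat) x : S x ->
  least n.+1 [set w | par n w = label_fine n x /\ reach Z par n.+1 w x]
    (label_fine n.+1 x).
Proof.
move=> Sx /=; have [Zn rn] := label_fine_spec n Sx.
have [v [Zv pv vx]] := reach_child Sx Zn rn.
have en : n%:Z + 1 = n.+1 by lia.
rewrite en in Zv vx.
have [|u lu] := @least_exists n.+1 [set w | par n w = label_fine n x /\
                                          reach Z par n.+1 w x]; first by exists v.
by case: xgetP => [//|/(_ u)].
Qed.

Lemma label_fine0_least x : S x ->
  least 0 [set w | reach Z par 0 w x] (label_fine 0 x).
Proof.
move=> Sx /=; have [w Zw wx] := reach_root Sx.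
have [|v lv] := @least_exists 0 [set w | reach Z par 0 w x]; first by exists w.
by case: xgetP => [//|/(_ v)].
Qed.

Lemma par_label k x : S x -> par k (label (k + 1) x) = label k x.
Proof.
move=> Sx; case: k => n.
  rewrite (_ : Posz n + 1 = n.+1); last by lia.
  by have [_ [+ _] _] := label_fine_least n Sx.
case: n => [|n]; first by rewrite (_ : Negz 0 + 1 = 0%N).
by rewrite (_ : Negz n.+1 + 1 = Negz n)//; lia.
Qed.

Lemma label_spec k x : S x -> Z k (label k x) /\ reach Z par k (label k x) x.
Proof.
move=> Sx; case: k => n; first exact: label_fine_spec.
have key k : Z (k + 1) (label (k + 1) x) -> reach Z par (k + 1) (label (k + 1) x) x ->
    Z k (label k x) /\ reach Z par k (label k x) x.
  rewrite -(par_label k Sx) => Zk rk; split; last exact: reach_par.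
  exact/parZ/(ZS Zk).
elim: n => [|n [Zn rn]]; apply: key.
- by have [] := label_fine_spec 0 Sx.
- by have [] := label_fine_spec 0 Sx.
- by rewrite (_ : Negz n.+1 + 1 = Negz n)//; lia.
- by rewrite (_ : Negz n.+1 + 1 = Negz n)//; lia.
Qed.

Definition cube k w : set (Rd R d) := [set x | S x /\ label k x = w].

Hypothesis mS : measurable (S : set (Rd R d)).
Hypothesis countZ : forall k, countable (Z k).

Lemma measurable_bigcup_countable (D : set 'rV[R]_d) (F : 'rV[R]_d -> set (Rd R d)) :
  countable D -> (forall i, D i -> measurable (F i)) ->
  measurable (\bigcup_(i in D) F i).
Proof.
apply: bigcup_countable_closed; first exact: measurable0.
by move=> G; exact: bigcupT_measurable.
Qed.

Lemma measurable_reach k w : measurable (reach Z par k w : set (Rd R d)).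
Proof. by apply: closed_measurable_Rd; exact: closed_reach. Qed.

Lemma cube_empty k w : ~ Z k w -> cube k w = set0.
Proof.
move=> Zw; apply/seteqP; split=> // x [Sx xw]; apply: Zw.
by rewrite -xw; exact: (label_spec k Sx).1.
Qed.

Lemma measurable_least k (P : 'rV[R]_d -> set (Rd R d)) w : Z k w ->
  (forall v, Z k v -> measurable (P v)) ->
  measurable ((S `&` [set x | least k [set v | P v x] w]) : set (Rd R d)).
Proof.
move=> Zw mP.
rewrite (_ : _ `&` _ =
   (S `&` P w) `\` \bigcup_(v in Z k `&` [set v | (num k v < num k w)%N]) P v).
  apply: measurableD; first by apply: measurableI => //; exact: mP.
  apply: measurable_bigcup_countable => [|v [Zv _]]; last exact: mP.
  by apply: sub_countable (countZ k); apply: subset_card_le => v [].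
apply/seteqP; split=> x /=.
  move=> [Sx [_ Pw h]]; split=> // -[v [Zv vw] Pv].
  by have := h _ Zv Pv; rewrite leqNgt vw.
move=> [[Sx Pw] h]; split=> //; split=> // v Zv Pv.
by rewrite leqNgt; apply/negP => vw; apply: h; exists v.
Qed.

(** A cube of negative level is a countable union of cubes of the next level. From level 0 on, cubes
    are cut out by the closed sets [reach] and the countably many of them numbered before. *)
Lemma measurable_cube k w : measurable (cube k w).
Proof.
have [Zw|/cube_empty->//] := pselect (Z k w).
case: k Zw => n; last first.
  have key k v : (forall u, Z (k + 1) u -> measurable (cube (k + 1) u)) ->
      measurable (cube k v).
    move=> h.
    have -> : cube k v = \bigcup_(u in Z (k + 1) `&` [set u | par k u = v]) cube (k + 1) u.
      apply/seteqP; split=> x.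
        move=> [Sx xv]; exists (label (k + 1) x) => //; split.
          exact: (label_spec _ Sx).1.
        by rewrite /= par_label.
      by move=> [u [Zu /= <-] [Sx <-]]; split=> //; rewrite par_label.
    apply: measurable_bigcup_countable => [|u [Zu _]]; last exact: h.
    by apply: sub_countable (countZ (k + 1)); apply: subset_card_le => u [].
  move=> _; have h0 v : Z 0 v -> measurable (cube 0 v).
    move=> Zv; rewrite (_ : cube _ _ = S `&` [set x | least 0 [set w | reach Z par 0 w x] v]).
      by apply: measurable_least => // u _; exact: measurable_reach.
    apply/seteqP; split=> x [Sx]; first by move=> <-; split=> //; exact: label_fine0_least.
    move=> xv; split=> //; apply: least_uniq xv; exact: label_fine0_least.
  elim: n w => [|n ih] w; apply: key => u Zu; first exact: h0.
  by rewrite (_ : Negz n.+1 + 1 = Negz n)//; lia.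
elim: n w => [|n ih] w Zw.
  rewrite (_ : cube _ _ = S `&` [set x | least 0 [set w | reach Z par 0 w x] w]).
    by apply: measurable_least => // u _; exact: measurable_reach.
  apply/seteqP; split=> x [Sx]; first by move=> <-; split=> //; exact: label_fine0_least.
  move=> xv; split=> //; apply: least_uniq xv; exact: label_fine0_least.
have mn u : measurable (cube n u).
  by have [/ih//|/cube_empty->] := pselect (Z n u); exact: measurable0.
(* The condition on the parent involves the label of [x]; rewritten as membership of [x] in the cube
   of [par n v], it is measurable by induction. *)
rewrite (_ : cube _ _ = S `&` [set x | least n.+1
  [set v | (cube n (par n v) `&` reach Z par n.+1 v) x] w]).
  by apply: measurable_least => // u _; apply: measurableI => //; exact: measurable_reach.
have e x : S x -> [set v | (cube n (par n v) `&` reach Z par n.+1 v) x] =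
    [set w | par n w = label_fine n x /\ reach Z par n.+1 w x].
  by move=> Sx; apply/seteqP; split=> v [h1 h2]; split=> //; case: h1.
apply/seteqP; split=> x [Sx] /=.
  by move=> <-; split=> //; rewrite e//; exact: label_fine_least.
rewrite e// => xv; split=> //; apply: least_uniq xv; exact: label_fine_least.
Qed.

End labels.

(** The interface to the tree: parents, limit sets and numberings do not leave this proof. A cube of
    level [k] is a level set of [lab k], and nestedness says that the label at level [k + 1]
    determines the one at level [k]. *)
Theorem exists_labels {R : realType} {d : nat} (S : set 'rV[R]_d)
    (good : int -> 'rV[R]_d -> Prop) : measurable (S : set (Rd R d)) ->
  exists (Z : int -> set 'rV[R]_d) (lab : int -> 'rV[R]_d -> 'rV[R]_d),
  [/\ forall k, Z k `<=` S /\ countable (Z k),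
      forall k x, S x -> Z k (lab k x) /\
        eucl_dist x (lab k x) < 6 * rad good k (lab k x),
      forall k w x, Z k w -> S x -> eucl_dist x w < rad good k w -> lab k x = w,
      forall k x, S x ->
        eucl_dist (lab (k + 1) x) (lab k x) < 4 * rad good k (lab k x) &
      (forall k x y, S x -> S y -> lab (k + 1) x = lab (k + 1) y -> lab k x = lab k y)
      /\ forall k w, measurable ([set x | S x /\ lab k x = w] : set (Rd R d))].
Proof.
move=> mS; have [Z hZ] := @choice _ _ _ (exists_centers S good).
have ZS k : Z k `<=` S by case: (hZ k).
have Zsep k v w : Z k v -> Z k w -> v != w -> 4 * rad good k v <= eucl_dist v w.
  by case: (hZ k) => _ h _; exact: h.
have Zcov k x : S x -> exists2 w, Z k w & eucl_dist x w < 4 * rad good k w.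
  by case: (hZ k) => _ _; exact.
have countZ k : countable (Z k).
  apply: (@separated_countable _ _ (4 * rho k)); first exact: rho4_gt0.
  exact: centers_separated Zsep k.
have [par hpar] : exists par : int -> 'rV[R]_d -> 'rV[R]_d, forall k v, S v ->
    [/\ Z k (par k v), eucl_dist v (par k v) < 4 * rad good k (par k v) &
      forall u, Z k u -> eucl_dist v u < 2 * rad good k u -> par k v = u].
  have h (kv : int * 'rV[R]_d) : exists w, S kv.2 ->
     [/\ Z kv.1 w, eucl_dist kv.2 w < 4 * rad good kv.1 w &
      forall u, Z kv.1 u -> eucl_dist kv.2 u < 2 * rad good kv.1 u -> w = u].
    have [Sv|nS] := pselect (S kv.2); last by exists 0.
    by have [w hw] := exists_parent Zsep Zcov kv.1 Sv; exists w.
  have [f hf] := choice h; exists (fun k v => f (k, v)) => k v; exact: (hf (k, v)).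
have parZ k v : S v -> Z k (par k v) by move=> /(hpar k)[].
have pard k v : S v -> eucl_dist v (par k v) < 4 * rad good k (par k v).
  by move=> /(hpar k)[].
have parn k v u : S v -> Z k u -> eucl_dist v u < 2 * rad good k u -> par k v = u.
  by move=> /(hpar k)[_ _]; exact.
have hnum k : exists f : 'rV[R]_d -> nat, {in Z k &, injective f}.
  exact/countable_injP.
have [num num_inj] := choice hnum.
have rroot x : S x -> exists2 w, Z 0 w & reach Z par 0 w x.
  by move=> Sx; exact: (reach_root ZS Zsep Zcov parZ pard 0 Sx).
have rchild k w x : S x -> Z k w -> reach Z par k w x ->
    exists v, [/\ Z (k + 1) v, par k v = w & reach Z par (k + 1) v x].
  exact: (reach_child ZS Zsep Zcov parZ pard parn).
have spec k x : S x ->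
    Z k (label Z par num k x) /\ reach Z par k (label Z par num k x) x.
  exact: label_spec.
have plab k x : S x -> par k (label Z par num (k + 1) x) = label Z par num k x.
  exact: par_label.
exists Z, (label Z par num); split.
- by [].
- move=> k x Sx; have [Zk rk] := spec k x Sx; split=> //.
  exact: reach_dist rk.
- move=> k w x Zw Sx xw; have [Zk rk] := spec k x Sx.
  by move: rk; apply: reach_near xw.
- move=> k x Sx; rewrite -(plab k x Sx); apply: pard.
  exact: ZS (spec (k + 1) x Sx).1.
- split=> [k x y Sx Sy xy|k w]; first by rewrite -(plab k x Sx) -(plab k y Sy) xy.
  by apply: (@measurable_cube R d S Z par num).
Qed.

(** * Measures of polynomial growth *)

Section growth.
Context {R : realType} {d : nat} {n : R}.
Variable mu : {measure set (Rd R d) -> \bar R}.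
Hypothesis mu_growth : polynomial_growth mu n.
Implicit Types (x y v w : 'rV[R]_d) (r s : R).

Definition mass x r : R := fine (mu (eucl_ball x r)).

Lemma eucl_ball_le0 x r : r <= 0 -> eucl_ball x r = set0.
Proof.
move=> r0; apply/seteqP; split=> // y; rewrite /eucl_ball/= => xy.
by have := eucl_dist_ge0 x y; rewrite leNgt (lt_le_trans xy).
Qed.

Lemma mu_ball_fin x r : mu (eucl_ball x r) \is a fin_num.
Proof.
have [r0|r0] := leP r 0; first by rewrite eucl_ball_le0// measure0.
rewrite ge0_fin_numE//; apply: le_lt_trans (mu_growth x r0) _.
by rewrite ltry.
Qed.

Lemma massE x r : mu (eucl_ball x r) = (mass x r)%:E.
Proof. by rewrite fineK// mu_ball_fin. Qed.

Lemma mass_ge0 x r : 0 <= mass x r.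
Proof. by rewrite fine_ge0. Qed.

Lemma mass_le x r : 0 < r -> mass x r <= r `^ n.
Proof. by move=> /(mu_growth x); rewrite massE lee_fin. Qed.

Lemma le_mass x y r s : eucl_dist x y + r <= s -> mass y r <= mass x s.
Proof.
move=> h; rewrite -lee_fin -!massE le_measure ?inE//.
- exact: measurable_eucl_ball.
- exact: measurable_eucl_ball.
- exact: subset_eucl_ball.
Qed.

Lemma mass_gt0 x r : supp mu x -> 0 < r -> 0 < mass x r.
Proof. by move=> /(_ r) h /h; rewrite massE lte_fin. Qed.

Lemma open_not_supp : open (~` (supp mu) : set 'rV[R]_d).
Proof.
apply/open_euclP => x /existsNP[r /not_implyP[r0 /negP]].
rewrite massE lte_fin -leNgt => mx0; exists (r / 2); first by rewrite divr_gt0.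
move=> y xy sy; have r20 : 0 < r / 2 by rewrite divr_gt0.
have := mass_gt0 sy r20; rewrite ltNge => /negP; apply.
apply: le_trans mx0; apply: le_mass.
by move: xy; rewrite /eucl_ball/=; lra.
Qed.

Lemma measurable_supp : measurable (supp mu).
Proof.
rewrite -[supp mu]setCK; apply: measurableC; apply: open_measurable_Rd.
exact: open_not_supp.
Qed.

Lemma rat_dense x r : 0 < r ->
  exists q : {ffun 'I_d -> rat}, eucl_dist x (\row_i ratr (q i)) < r.
Proof.
move=> r0; have e0 : 0 < r / d.+1%:R by rewrite divr_gt0.
have h i : exists q : rat, `|x ord0 i - ratr q| < r / d.+1%:R.
  have [|q] := @rat_in_itvoo R (x ord0 i) (x ord0 i + r / d.+1%:R).
    by rewrite ltrDl.
  rewrite in_itv/= => /andP[q1 q2]; exists q.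
  by rewrite distrC gtr0_norm ?subr_gt0// ltrBlDl.
have [f hf] := choice h; exists [ffun i => f i].
rewrite [ltRHS](_ : _ = d.+1%:R * (r / d.+1%:R)); last by rewrite mulrCA divff ?mulr1.
by apply: eucl_dist_lt_coord => // i; rewrite !mxE ffunE.
Qed.

(** Every point outside the support lies in a null ball with rational center and radius, and there
    are countably many of these. *)
Lemma negligible_setC_supp : mu.-negligible (~` supp mu).
Proof.
pose I : Type := ({ffun 'I_d -> rat} * rat)%type.
pose F (i : I) : set (Rd R d) := eucl_ball (\row_j ratr (i.1 j)) (ratr i.2).
have : mu.-negligible (\bigcup_(i in [set i | mu (F i) = 0]) F i).
  apply: (@bigcup_countable_closed _ _ (fun A => mu.-negligible A)).
  - exact: negligible_set0.
  - exact: negligible_bigcup.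
  - exact: countableP.
  - by move=> i /= mF0; apply/negligibleP => //; exact: measurable_eucl_ball.
apply: negligibleS => x /existsNP[r /not_implyP[r0 /negP]].
rewrite -leNgt => mx0.
have r40 : 0 < r / 4 by rewrite divr_gt0.
have [q xq] := rat_dense x r40.
have [|s] := @rat_in_itvoo R (r / 4) (r / 2); first by lra.
rewrite in_itv/= => /andP[s1 s2].
exists (q, s) => /=; last by rewrite /F /eucl_ball/= eucl_distC; lra.
apply/eqP; rewrite -measure_le0; apply: le_trans mx0.
rewrite le_measure ?inE//; try exact: measurable_eucl_ball.
by apply: subset_eucl_ball; lra.
Qed.

Lemma negligible_squeeze (E : set (Rd R d)) (C : R) :
  (forall s : nat, exists B : set (Rd R d),
    [/\ measurable B, E `<=` B & (mu B <= (C / 2 ^+ s)%:E)%E]) ->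
  mu.-negligible E.
Proof.
move=> h; have [B hB] := choice h.
exists (\bigcap_s B s); split.
- by apply: bigcapT_measurable => s; case: (hB s).
- apply/eqP; rewrite -measure_le0; apply/lee_addgt0Pr => e e0; rewrite add0e.
  have C0 : 0 <= C.
    have [_ _] := hB 0%N; rewrite expr0 divr1 => /(le_trans (measure_ge0 _ _)).
    by rewrite lee_fin.
  pose s := (Num.truncn (C / e)).+1.
  have [mBs _ Bs] := hB s; apply: (@le_trans _ _ (mu (B s))).
    rewrite le_measure ?inE//; last exact: bigcap_inf.
    by apply: bigcapT_measurable => s'; case: (hB s').
  apply: le_trans Bs _; rewrite lee_fin ler_pdivrMr ?exprn_gt0//.
  rewrite mulrC -ler_pdivrMr//; apply: (@le_trans _ _ s%:R).
    by rewrite ltW// real_truncnS_gt ?num_real.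
  by rewrite -natrX ler_nat ltnW// ltn_expl.
- by move=> x Ex s _; case: (hB s) => _ + _; exact.
Qed.

(* A grid of mesh [ratio ^- s] has [O(ratio ^ (s d))] cells in a bounded region,
   each contained in a ball of mass [O(b ^- s)]. *)
Lemma negligible_thin (E : set (Rd R d)) (r0 c b : R) : 0 < r0 ->
  2 * ratio ^+ d <= b ->
  (forall x, E x -> forall s : nat, mass x (r0 / ratio ^+ s) <= c / b ^+ s) ->
  mu.-negligible E.
Proof.
move=> r00 bd hE.
have rp : 0 < (ratio : R) by exact: ratio_gt0.
have b0 : 0 < b by apply: lt_le_trans bd; rewrite mulr_gt0// exprn_gt0.
have -> : E = \bigcup_K (E `&` box K%:R).
  rewrite -setI_bigcupr; apply/seteqP; split=> [x Ex|x []//]; split=> //.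
  have [K _ xK] : (\bigcup_(n in [set: nat]) eucl_ball (0 : 'rV[R]_d) n%:R) x.
    by rewrite bigcup_ball.
  exists K => // i; have := coord_le_eucl_dist x 0 i; rewrite mxE subr0.
  by move=> /le_trans; apply; rewrite eucl_distC ltW.
apply: negligible_bigcup => K.
set EK := E `&` box K%:R.
have [[x0 Ex0]|EK0] := pselect (exists x, E x); last first.
  apply: negligibleS (@negligible_set0 _ _ _ mu) => x [Ex _].
  by apply: EK0; exists x.
have c0 : 0 <= c.
  by have := hE _ Ex0 0%N; rewrite !expr0 !divr1; apply: le_trans; exact: mass_ge0.
(* The grid has N + 2 indices per axis and N <= 2K(d + 1) ratio^s / r0, so N + 2 <= L ratio^s. *)
pose L : R := 2 * K%:R * d.+1%:R / r0 + 2.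
have L0 : 0 <= L by rewrite /L addr_ge0// divr_ge0// ?mulr_ge0// ltW.
apply: (@negligible_squeeze _ (L ^+ d * c)) => s.
have rs0 : 0 < ratio ^+ s :> R by rewrite exprn_gt0.
pose rs := r0 / ratio ^+ s.
have rs_gt0 : 0 < rs by rewrite divr_gt0.
pose e := rs / d.+1%:R.
have e0 : 0 < e by rewrite divr_gt0.
pose N := (Num.truncn ((K%:R + K%:R) / e)).
have KN : K%:R + K%:R <= e * N.+1%:R.
  by rewrite mulrC -ler_pdivrMr// ltW// real_truncnS_gt ?num_real.
pose T : finType := {ffun 'I_d -> 'I_N.+2}.
(* Each covering ball is centered at a point of [E], since only there is the mass bound
   available. *)
pose rep (f : T) : 'rV[R]_d := xget 0 [set x | EK x /\ cell K%:R e N.+1 x = f].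
pose G (f : T) : set (Rd R d) :=
  if `[< exists x, EK x /\ cell K%:R e N.+1 x = f >] then eucl_ball (rep f) rs else set0.
have mG f : measurable (G f).
  by rewrite /G; case: asboolP => _ //; exact: measurable_eucl_ball.
pose f0 : T := cell K%:R e N.+1 0.
pose A (i : nat) := G (nth f0 (enum T) i).
exists (\big[setU/set0]_(i < #|T|) A i); split.
- by apply: bigsetU_measurable => i _; exact: mG.
- move=> x xE; rewrite -bigcup_mkord; set f : T := cell K%:R e N.+1 x.
  exists (enum_rank f); first exact: (ltn_ord (enum_rank f)).
  have -> : A (enum_rank f) = G f by rewrite /A -enum_val_nth enum_rankK.
  rewrite /G; case: asboolP => [_|[]]; last by exists x.
  rewrite /rep; case: xgetP => [y _ [yE yf]|/(_ x)]; last by case.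
  have := cell_inj e0 KN yE.2 xE.2 yf.
  by rewrite /e mulrCA divff ?mulr1.
- have GE f : (mu (G f) <= (c / b ^+ s)%:E)%E.
    rewrite /G; case: asboolP => [[x hx]|_]; last first.
      by rewrite measure0 lee_fin divr_ge0// exprn_ge0// ltW.
    rewrite massE lee_fin /rep; case: xgetP => [y _ [[Ey _] _]|/(_ x)//].
    exact: hE.
  apply: le_trans; first by apply: Boole_inequality => i _; exact: mG.
  apply: (@le_trans _ _ (\sum_(i < #|T|) (c / b ^+ s)%:E)%E).
    by apply: lee_sum => i _; exact: GE.
  rewrite sumEFin lee_fin sumr_const card_ord card_ffun !card_ord.
  have NL : N.+2%:R <= L * ratio ^+ s.
    have := truncn_itv (divr_ge0 (addr_ge0 (ler0n R K) (ler0n R K)) (ltW e0)).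
    rewrite -/N => /andP[N1 _].
    rewrite -addn2 natrD /L mulrDl lerD//.
      apply: le_trans N1 _; rewrite /e /rs le_eqVlt; apply/orP; left; apply/eqP.
      by rewrite !invfM !invrK; ring.
    by rewrite ler_peMr// exprn_ege1// ltW// ratio_gt1.
  rewrite -[leLHS]mulr_natl natrX.
  have h1 : N.+2%:R ^+ d <= L ^+ d * (ratio ^+ d) ^+ s :> R.
    rewrite -exprM mulnC exprM -exprMn; apply: lerXn2r NL; rewrite ?nnegrE//.
    by rewrite mulr_ge0// ltW.
  have h2 : (ratio ^+ d) ^+ s / b ^+ s <= 1 / 2 ^+ s :> R.
    rewrite ler_pdivrMr ?exprn_gt0// mulrAC mul1r ler_pdivlMr ?exprn_gt0//.
    rewrite -exprMn; apply: lerXn2r; rewrite ?nnegrE ?(ltW b0)//.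
      by rewrite mulr_ge0// exprn_ge0// ltW.
    by rewrite mulrC.
  apply: (@le_trans _ _ (L ^+ d * (ratio ^+ d) ^+ s * (c / b ^+ s))).
    by rewrite ler_wpM2r// divr_ge0// exprn_ge0// ltW.
  have -> : L ^+ d * (ratio ^+ d) ^+ s * (c / b ^+ s) =
    (L ^+ d * c) * ((ratio ^+ d) ^+ s / b ^+ s) by ring.
  have -> : L ^+ d * c / 2 ^+ s = (L ^+ d * c) * (1 / 2 ^+ s) by rewrite div1r.
  by rewrite ler_wpM2l// mulr_ge0// exprn_ge0.
Qed.

End growth.

(** * Sigma-algebras generated by disjoint atoms *)

Section generated_atoms.
Context {R : realType} {d : nat}.
Variable mu : {measure set (Rd R d) -> \bar R}.
Hypothesis msupp : measurable (supp mu).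
Variable AA : set (set (Rd R d)).
Hypothesis AA_supp : forall A, AA A -> A `<=` supp mu.
Hypothesis AA_measurable : forall A, AA A -> measurable A.
Hypothesis AA_nonnull : forall A, AA A -> ~ mu.-negligible A.
Hypothesis AA_disjoint : trivIset AA id.
Hypothesis AA_cover : ae_subset mu (supp mu) (\bigcup_(Q in AA) Q).

(** For fixed [Q], the sets that miss or contain [Q] form a sigma-algebra on the support;
    disjointness puts the generators into it. *)
Lemma generated_dichotomy A Q : <<s supp mu, AA >> A -> AA Q ->
  A `&` Q = set0 \/ Q `<=` A.
Proof.
move=> GA AQ; move: A GA.
apply: (@smallest_sub _ _ _ [set A | A `&` Q = set0 \/ Q `<=` A]).
  split=> /=.
  - by left; rewrite set0I.
  - move=> A [AQ0|QA].
      right=> x Qx; split; first exact: AA_supp Qx.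
      by move=> Ax; suff : (A `&` Q) x by rewrite AQ0.
    by left; apply/seteqP; split=> // x [[_ nA] /QA].
  - move=> F hF; have [[i Qi]|h] := pselect (exists i, Q `<=` F i).
      by right=> x /Qi Fx; exists i.
    left; apply/seteqP; split=> // x [[i _ Fx] Qx].
    by have [FQ0|] := hF i; [suff : (F i `&` Q) x by rewrite FQ0|move=> QF; apply: h; exists i].
move=> A AA_A; have [/eqP|/set0P[x [Ax Qx]]] := eqVneq (A `&` Q) set0.
  by move=> /eqP; left.
right; suff -> : A = Q by [].
by apply: AA_disjoint => //; exists x.
Qed.

Lemma sub_sigma_algebra_generated : sub_sigma_algebra_supp mu <<s supp mu, AA >>.
Proof.
split; first exact: smallest_sigma_algebra.
  move=> A; apply: (@smallest_sub _ _ _ [set A | A `<=` supp mu]) => //.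
  split=> /=; first exact: sub0set.
    by move=> B _ x [].
  by move=> F hF x [i _ /hF].
apply: smallest_sub => //; split; first exact: measurable0.
  by move=> B mB; exact: measurableD.
by move=> F mF; exact: bigcupT_measurable.
Qed.

(** A non-null [Q] of the sigma-algebra meets some member of [AA], because these cover the support
    up to a null set. By the dichotomy it contains that member, and by minimality equals it. *)
Lemma atoms_generated : atoms mu <<s supp mu, AA >> = AA.
Proof.
apply/seteqP; split=> Q; last first.
  move=> AQ; split; [exact: sub_gen_smallest|exact: AA_nonnull|].
  move=> A /generated_dichotomy/(_ AQ) [AQ0|QA] AQ'; last by right; apply/seteqP.
  by left; rewrite -AQ0; apply/seteqP; split=> x; [move=> Ax; split=> //; exact: AQ'|case].
move=> [GQ nnQ Qmin].
have [[A [AA_A /set0P[x [Ax Qx]]]]|h] := pselect (exists A, AA A /\ A `&` Q != set0).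
  have [QA0|AQ] := generated_dichotomy GQ AA_A.
    by exfalso; suff : (Q `&` A) x by rewrite QA0.
  have [] := Qmin A _ AQ; first exact: sub_gen_smallest.
    by move=> A0; move: Ax; rewrite A0.
  by move=> <-.
exfalso; apply: nnQ; apply: negligibleS AA_cover => x Qx; split.
  by have [_ + _] := sub_sigma_algebra_generated; apply; [exact: GQ|].
move=> [A AA_A Ax]; apply: h; exists A; split=> //.
by apply/set0P; exists x.
Qed.

Lemma atomic_generated : atomic mu <<s supp mu, AA >>.
Proof. by split; rewrite atoms_generated. Qed.

End generated_atoms.

(** * Integration lemmas *)

Section integral_lemmas.
Context d (T : measurableType d) (R : realType).
Variable mu : {measure set T -> \bar R}.
Local Open Scope ereal_scope.

Lemma ge0_integral_cover (f : T -> \bar R) (D A B : set T) (a b : \bar R) :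
  measurable_fun setT f -> (forall x, 0 <= f x) ->
  measurable D -> measurable A -> measurable B -> D `<=` A `|` B ->
  \int[mu]_(x in A) f x <= a -> \int[mu]_(x in B) f x <= b ->
  \int[mu]_(x in D) f x <= a + b.
Proof.
move=> mf f0 mD mA mB DAB Aa Bb.
have mBA : measurable (B `\` A) by exact: measurableD.
apply: (@le_trans _ _ (\int[mu]_(x in A `|` (B `\` A)) f x)).
  apply: ge0_subset_integral => //; [exact: measurableU|exact: measurable_funTS|].
  by move=> y /DAB[|By]; [left|have [|] := pselect (A y); [left|right]].
rewrite ge0_integral_setU//.
- apply: leeD => //; apply: le_trans Bb.
  by apply: ge0_subset_integral => //; exact: measurable_funTS.
- exact: measurable_funTS.
- by rewrite disj_set2E setDIK.
Qed.

(** Dominated convergence for the restrictions of [g] to the sets [W k]: almost everywhere they are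
    eventually 0. *)
Lemma integral_tail (g : T -> \bar R) (W : nat -> set T) (e : R) :
  mu.-integrable setT g -> (forall x, 0 <= g x) ->
  (forall k, measurable (W k)) ->
  {ae mu, forall x, exists k0 : nat, forall k, (k0 <= k)%N -> ~ W k x} ->
  (0 < e)%R -> exists k, \int[mu]_(x in W k) g x <= e%:E.
Proof.
move=> ig g0 mW ev e0; apply: contrapT => h.
have mg : measurable_fun setT g by case/integrableP: ig.
have [|||||_ _] := @dominated_convergence _ _ _ mu setT measurableT
    (fun k => g \_ (W k)) (cst 0) g.
- move=> k; apply/measurable_restrict => //.
  by rewrite setTI; exact: measurable_funTS.
- exact: measurable_cst.
- apply: filterS ev => x [k0 hk0] _.
  apply: cvg_near_cst; exists k0 => // k /= k0k.
  by rewrite patchE; case: ifPn => // /set_mem /(hk0 _ k0k).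
- exact: ig.
- apply: nearW => x k _; rewrite patchE; case: ifPn => _; last by rewrite abse0.
  by rewrite gee0_abs.
rewrite integral0 => cv.
have := cv; move=> /cvg_lim => /(_ (@ereal_hausdorff _)) lim0.
suff : e%:E <= 0 by rewrite lee_fin leNgt e0.
rewrite -lim0; apply: lime_ge; first by apply/cvg_ex; exists 0.
apply: nearW => k /=; rewrite -integral_mkcond leNgt; apply/negP => /ltW he.
by apply: h; exists k.
Qed.

End integral_lemmas.

Section kernel_integral.
Context {R : realType} {d : nat} {n : R}.
Variable mu : {measure set (Rd R d) -> \bar R}.
Hypothesis mu_growth : polynomial_growth mu n.
Hypothesis n_gt0 : 0 < n.
Implicit Types (x y v w : 'rV[R]_d) (A B D : set (Rd R d)) (c r s : R).

(** The real power is finite everywhere; at y = x it differs from the inverse in the extended reals.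
    [kernel_integralE] identifies the two integrals on regions avoiding a ball that contains [x]. *)
Definition kernel_integral x D : \bar R :=
  (\int[mu]_(y in D) (eucl_dist x y `^ (- n))%:E)%E.

Lemma measurable_kernel x D :
  measurable_fun D ((fun y => (eucl_dist x y `^ (- n))%:E) : Rd R d -> \bar R).
Proof.
apply/measurable_EFinP.
apply: (@measurableT_comp _ _ _ _ _ _ (fun t : R => t `^ (- n))) => //.
by apply: measurable_funTS; exact: measurable_eucl_dist.
Qed.

Lemma kernel_ge0 x y : (0 <= (eucl_dist x y `^ (- n))%:E)%E.
Proof. by rewrite lee_fin powR_ge0. Qed.

Lemma kernel_integral_cover x D A B (a b : R) : measurable D -> measurable A ->
  measurable B -> D `<=` A `|` B ->
  (kernel_integral x A <= a%:E)%E -> (kernel_integral x B <= b%:E)%E ->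
  (kernel_integral x D <= (a + b)%:E)%E.
Proof.
move=> mD mA mB DAB Aa Bb; rewrite EFinD.
apply: ge0_integral_cover DAB Aa Bb => //; first exact: measurable_kernel.
by move=> y; exact: kernel_ge0.
Qed.

Lemma powRN_anti c r : 0 < c -> c <= r -> r `^ (- n) <= c `^ (- n).
Proof.
move=> c0 cr; rewrite !powRN lef_pV2 ?posrE ?powR_gt0//; last exact: lt_le_trans cr.
by apply: ge0_ler_powR => //; rewrite ?nnegrE ltW//; exact: lt_le_trans cr.
Qed.

(** The lower bound on the distance is asked on the support only; [same_cube_le] relies on this, as
    its region may come close to [x] off the support. *)
Lemma kernel_integral_le x D c w s : mu.-negligible (~` supp mu) -> measurable D ->
  0 < c -> D `<=` eucl_ball w s ->
  (forall y, D y -> supp mu y -> c <= eucl_dist x y) ->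
  (kernel_integral x D <= (mass mu w s * c `^ (- n))%:E)%E.
Proof.
move=> nS mD c0 Dws far.
apply: (@le_trans _ _ (\int[mu]_(y in D) (c `^ (- n))%:E)%E).
  apply: ae_ge0_le_integral => //.
  - by move=> y _; exact: kernel_ge0.
  - exact: measurable_kernel.
  - by move=> y _; rewrite lee_fin powR_ge0.
  apply: negligibleS nS => y /= h Sy; apply: h => Dy.
  by rewrite lee_fin powRN_anti// far.
rewrite integral_cst// mulrC EFinM lee_wpmul2l ?lee_fin ?powR_ge0//.
rewrite -(massE mu_growth) le_measure ?inE//; exact: measurable_eucl_ball.
Qed.

Lemma kernel_integralE x D w r : eucl_dist x w < r ->
  D `<=` ~` eucl_ball w r ->
  (\int[mu]_(y in D) ((eucl_dist x y `^ n)%:E)^-1 = kernel_integral x D)%E.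
Proof.
move=> xw Dw; apply: eq_integral => y /set_mem/Dw.
rewrite /eucl_ball/= => /negP; rewrite -leNgt => wy.
have d0 : 0 < eucl_dist x y.
  by have := eucl_dist_triangle x w y; rewrite (eucl_distC w x); lra.
by rewrite inver gt_eqF ?powR_gt0// powRN.
Qed.

End kernel_integral.

(** * Weak-* density *)

Section approximation.
Context d (T : measurableType d) (R : realType).
Variable mu : {measure set T -> \bar R}.
Variable S : set T.
Hypothesis mS : measurable S.
Hypothesis nullSC : mu.-negligible (~` S).
Variable Sg : int -> set (set T).
Hypothesis Sg_sigma : forall k, sigma_algebra S (Sg k).
Hypothesis Sg_sub : forall k A, Sg k A -> A `<=` S.
Hypothesis Sg_measurable : forall k, Sg k `<=` measurable.
Hypothesis Sg_mono : forall j k : int, j <= k -> Sg j `<=` Sg k.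
Variable g : T -> R.
Hypothesis ig : mu.-integrable setT (EFin \o g).
Hypothesis g0 : forall x, 0 <= g x.

Definition sym_diff (A U : set T) : set T := S `&` ((A `\` U) `|` (U `\` A)).

Definition weight (A : set T) : \bar R := (\int[mu]_(x in A) (g x)%:E)%E.

(** Approximation is measured by [g] times [mu], a finite measure even if [mu] is infinite, and the
    one that a test function of L1 sees. *)
Definition approximable : set (set T) := [set A | measurable A /\
  forall e : R, 0 < e -> exists k U, Sg k U /\ (weight (sym_diff A U) <= e%:E)%E].

Let mg : measurable_fun setT (EFin \o g).
Proof. by case/integrableP: ig. Qed.

Let Sg0 k : Sg k set0.
Proof. by case: (Sg_sigma k). Qed.

Let SgD k A : Sg k A -> Sg k (S `\` A).
Proof. by case: (Sg_sigma k) => _ + _; exact. Qed.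

Let SgU k A B : Sg k A -> Sg k B -> Sg k (A `|` B).
Proof.
move=> SA SB; rewrite -bigcup2E; case: (Sg_sigma k) => _ _; apply.
by case=> [|[|i]] //=; exact: Sg0.
Qed.

Let SgI k A B : Sg k A -> Sg k B -> Sg k (A `&` B).
Proof.
move=> SA SB; suff -> : A `&` B = S `\` ((S `\` A) `|` (S `\` B)).
  by apply: SgD; apply: SgU; exact: SgD.
apply/seteqP; split=> [x [Ax Bx]|x [Sx h]].
  split; first exact: (Sg_sub SA Ax).
  by move=> [[_ h]|[_ h]]; apply: h.
by split; apply: contrapT => nx; apply: h; [left|right].
Qed.

Lemma measurable_sym_diff A U : measurable A -> measurable U ->
  measurable (sym_diff A U).
Proof.
by move=> mA mU; apply: measurableI => //; apply: measurableU; exact: measurableD.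
Qed.

Lemma weight_cover D A B (a b : R) : measurable D -> measurable A ->
  measurable B -> D `<=` A `|` B ->
  (weight A <= a%:E -> weight B <= b%:E -> weight D <= (a + b)%:E)%E.
Proof.
move=> mD mA mB DAB Aa Bb; rewrite EFinD.
by apply: ge0_integral_cover DAB Aa Bb => // x; rewrite lee_fin.
Qed.

Lemma weight_set0 : weight set0 = 0%E.
Proof. exact: integral_set0. Qed.

Lemma approximable0 : approximable set0.
Proof.
split=> [|e e0]; first exact: measurable0.
exists 0, set0; split; first exact: Sg0.
by rewrite /sym_diff setDv setU0 setI0 weight_set0 lee_fin ltW.
Qed.

Lemma approximableC A : approximable A -> approximable (~` A).
Proof.
move=> [mA h]; split=> [|e e0]; first exact: measurableC.
have [k [U [SU we]]] := h e e0; exists k, (S `\` U); split; first exact: SgD.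
suff -> : sym_diff (~` A) (S `\` U) = sym_diff A U by [].
apply/seteqP; split=> x [Sx [[h1 h2]|[h1 h2]]]; split=> //.
- by right; split=> //; apply: contrapT => nU; apply: h2.
- by left; split; [exact: contrapT h2|case: h1].
- by right; split=> // -[].
- by left; split=> // -[].
Qed.

Lemma approximableU A B : approximable A -> approximable B ->
  approximable (A `|` B).
Proof.
move=> [mA hA] [mB hB]; split=> [|e e0]; first exact: measurableU.
have e20 : 0 < e / 2 by rewrite divr_gt0.
have [j [U [SU wU]]] := hA _ e20; have [k [V [SV wV]]] := hB _ e20.
have {}SU : Sg (Num.max j k) U by apply: Sg_mono SU; rewrite le_max lexx.
have {}SV : Sg (Num.max j k) V by apply: Sg_mono SV; rewrite le_max lexx orbT.
have mU := Sg_measurable SU; have mV := Sg_measurable SV.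
exists (Num.max j k), (U `|` V); split; first exact: SgU.
rewrite [e]splitr; apply: weight_cover wU wV; try exact: measurable_sym_diff.
  by apply: measurable_sym_diff; exact: measurableU.
move=> x [Sx [[[Ax|Bx] h]|[[Ux|Vx] h]]].
- by left; split=> //; left; split=> // Ux; apply: h; left.
- by right; split=> //; left; split=> // Ux; apply: h; right.
- by left; split=> //; right; split=> // Ax; apply: h; left.
- by right; split=> //; right; split=> // Ax; apply: h; right.
Qed.

(** It is enough to approximate a finite partial union beyond which the union has small weight. *)
Lemma approximable_bigcup (F : nat -> set T) : (forall i, approximable (F i)) ->
  approximable (\bigcup_i F i).
Proof.
move=> hF; have mF : measurable (\bigcup_i F i).
  by apply: bigcupT_measurable => i; case: (hF i).
split=> // e e0; have e20 : 0 < e / 2 by rewrite divr_gt0.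
pose B k := \big[setU/set0]_(i < k) F i.
have aB k : approximable (B k).
  by rewrite /B; apply: (big_ind approximable) => //; [exact: approximable0|exact: approximableU].
have mD k : measurable (S `&` (\bigcup_i F i `\` B k)).
  by apply: measurableI => //; apply: measurableD => //; case: (aB k).
have [||k wk] := integral_tail (W := fun k => S `&` (\bigcup_i F i `\` B k)) ig _ mD _ e20.
- by move=> x; rewrite lee_fin.
- apply: nearW => x; have [[i _ Fx]|h] := pselect ((\bigcup_i F i) x); last first.
    by exists 0%N => k _ [_ []].
  exists i.+1 => k ik [_ [_]]; apply; rewrite /B -bigcup_mkord.
  by exists i.
have [j [U [SU wU]]] := (aB k).2 _ e20; exists j, U; split=> //.
have mU := Sg_measurable SU.
rewrite [e]splitr; apply: weight_cover wk wU => //; try apply: measurable_sym_diff => //.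
  by case: (aB k).
move=> x [Sx [[Fx Ux]|[Ux Fx]]].
  by have [Bx|Bx] := pselect (B k x); [right; split=> //; left|left].
right; split=> //; right; split=> //; rewrite /B -bigcup_mkord => -[i _ Fix'].
by apply: Fx; exists i.
Qed.

Lemma approximable_sigma_algebra : sigma_algebra setT approximable.
Proof.
split; first exact: approximable0.
- by move=> A; rewrite setTD; exact: approximableC.
- by move=> F; exact: approximable_bigcup.
Qed.

Lemma approximable_cvg A (U : nat -> set T) : measurable A ->
  (forall k, Sg k%:Z (U k)) ->
  {ae mu, forall x, S x -> exists k0 : nat, forall k, (k0 <= k)%N -> (U k x <-> A x)} ->
  approximable A.
Proof.
move=> mA SU ev; split=> // e e0.
have mD k : measurable (sym_diff A (U k)).
  by apply: measurable_sym_diff => //; exact: Sg_measurable (SU k).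
have [||k wk] := integral_tail (W := fun k => sym_diff A (U k)) ig _ mD _ e0.
- by move=> x; rewrite lee_fin.
- apply: filterS ev => x h; have [Sx|nS] := pselect (S x); last first.
    by exists 0%N => k _ [].
  have [k0 hk0] := h Sx; exists k0 => k /hk0 [UA AU] [_ [[Ax]|[Ux]]]; apply.
    exact: AU.
  exact: UA.
by exists k%:Z, (U k).
Qed.

(** The sum is [t] times the number of positive multiples of [t] not exceeding [s]: rounding down,
    written in layer-cake form. *)
Lemma staircase (t s : R) (K : nat) : 0 < t -> 0 <= s -> s <= t * K%:R ->
  `|s - \sum_(i < K) t * (if t * i.+1%:R <= s then 1 else 0)| <= t.
Proof.
move=> t0 s0; elim: K => [|K ih] sK.
  by rewrite big_ord0 subr0; rewrite mulr0 in sK; rewrite (@le_anti _ _ s 0) ?s0 ?sK// normr0 ltW.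
rewrite big_ord_recr/=; have [sK'|sK'] := leP s (t * K%:R).
  rewrite ifF ?mulr0 ?addr0; first exact: ih.
  by apply/negbTE; rewrite -ltNge; apply: le_lt_trans sK' _; rewrite ltr_pM2l// ltr_nat.
rewrite (eq_bigr (fun=> t)) => [|i _]; last first.
  rewrite ifT ?mulr1//; apply: le_trans (ltW sK').
  by rewrite ler_pM2l// ler_nat.
rewrite sumr_const card_ord -mulr_natr.
rewrite -natr1 mulrDr mulr1 in sK *.
by case: ifP => h; rewrite ?mulr1 ?mulr0 ler_norml; apply/andP; split; lra.
Qed.

(** [B] is an arbitrary set of reals: the functions in view are finite sums of multiples of
    indicators, for which all preimages belong to the sigma-algebra. *)
Definition adapted k (h : T -> R) := forall B : set R, Sg k (S `&` h @^-1` B).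

Lemma adapted_cst k (c : R) : adapted k (fun=> c).
Proof.
move=> B; rewrite (_ : _ @^-1` _ = if c \in B then setT else set0).
  case: ifP => _; first by rewrite setIT -[S]setD0; apply: SgD.
  by rewrite setI0.
by case: ifPn => [/set_mem cB|/negP cB]; apply/seteqP; split=> x //= h; apply: cB; rewrite inE.
Qed.

Lemma adapted_indicator k (h : T -> R) (c : R) U : adapted k h -> Sg k U ->
  adapted k (fun x => h x + c * (\1_U x)).
Proof.
move=> ah SU B.
rewrite (_ : _ `&` _ = (U `&` (S `&` h @^-1` [set r | B (r + c)])) `|`
   ((S `\` U) `&` (S `&` h @^-1` B))).
  by apply: SgU; apply: SgI => //; first [exact: ah|exact: SgD].
apply/seteqP; split=> x.
  move=> [Sx /=]; have [Ux|Ux] := pselect (U x).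
    by rewrite indicE mem_set// mulr1 => h1; left.
  by rewrite indicE memNset// mulr0 addr0 => h1; right.
move=> [[Ux [Sx /=]]|[[_ Ux] [Sx /=]]]; first by rewrite indicE mem_set// mulr1.
by rewrite indicE memNset// mulr0 addr0.
Qed.

Lemma adapted_mono j k h : j <= k -> adapted j h -> adapted k h.
Proof. by move=> jk ah B; exact: (Sg_mono jk (ah B)). Qed.

End approximation.

Section function_approximation.
Context d (T : measurableType d) (R : realType).
Variable mu : {measure set T -> \bar R}.
Variable S : set T.
Hypothesis mS : measurable S.
Hypothesis nullSC : mu.-negligible (~` S).
Variable Sg : int -> set (set T).
Hypothesis Sg_sigma : forall k, sigma_algebra S (Sg k).
Hypothesis Sg_sub : forall k A, Sg k A -> A `<=` S.
Hypothesis Sg_measurable : forall k, Sg k `<=` measurable.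
Hypothesis Sg_mono : forall j k : int, j <= k -> Sg j `<=` Sg k.
Variable g : T -> R.
Hypothesis ig : mu.-integrable setT (EFin \o g).
Hypothesis g0 : forall x, 0 <= g x.
Hypothesis approxA : forall A, measurable A -> approximable mu S Sg g A.

Lemma adapted_layers (t c : R) (k : nat -> int) (U : nat -> set T) (K : nat) :
  (forall i, Sg (k i) (U i)) ->
  exists j, [/\ adapted S Sg j (fun x => c + \sum_(i < K) t * \1_(U i) x),
    measurable_fun setT (fun x => c + \sum_(i < K) t * \1_(U i) x) &
    exists B : R, forall x, `|c + \sum_(i < K) t * \1_(U i) x| <= B].
Proof.
move=> SU; elim: K => [|K [j [aj mj [B hB]]]].
  exists 0; have -> : (fun x : T => c + \sum_(i < 0) t * \1_(U i) x) = fun=> c.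
    by apply/funext => x; rewrite big_ord0 addr0.
  split; [exact: adapted_cst|exact: measurable_cst|exists `|c| => x].
  by rewrite big_ord0 addr0.
exists (Num.max j (k K)).
have -> : (fun x : T => c + \sum_(i < K.+1) t * \1_(U i) x) =
    fun x => (c + \sum_(i < K) t * \1_(U i) x) + t * \1_(U K) x.
  by apply/funext => x; rewrite big_ord_recr/= addrA.
split.
- apply: adapted_indicator => //.
    by apply: adapted_mono aj => //; rewrite le_max lexx.
  by apply: Sg_mono (SU K); rewrite le_max lexx orbT.
- apply: measurable_funD => //; apply: measurable_funM => //.
  by apply: measurable_indic; exact: Sg_measurable (SU K).
- exists (B + `|t|) => x; rewrite big_ord_recr/= addrA.
  apply: le_trans (ler_normD _ _) _; rewrite lerD//.
  rewrite normrM ler_piMr// indicE; case: (_ \in _); rewrite ?normr1 ?normr0//.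
Qed.

Lemma integral_indic_weight A : measurable A ->
  (\int[mu]_x (\1_A x * g x)%:E = weight mu g A)%E.
Proof.
move=> mA; rewrite /weight [RHS]integral_mkcond; apply: eq_integral => x _.
by rewrite patchE indicE; case: (x \in A); rewrite ?mul1r ?mul0r.
Qed.

(** Round [f + M], which lies in [0, 2M], down to multiples of t = 2M / K, and replace each
    superlevel set [A i] by a set [U i] of the filtration. With G the integral of [g], rounding
    costs tG <= e/2, and the K replacements, each of weight at most e' = e / (4M), cost tKe' =
    e/2. *)
Lemma function_approx (f : T -> R) (M e : R) : measurable_fun setT f ->
  {ae mu, forall x, `|f x| <= M} -> 0 < M -> 0 < e ->
  exists k h, [/\ adapted S Sg k h, measurable_fun setT h,
    exists B : R, forall x, `|h x| <= B &
    (\int[mu]_x (`|f x - h x| * g x)%:E <= e%:E)%E].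
Proof.
move=> mf fM M0 e0.
have mg : measurable_fun setT g by apply/measurable_EFinP; case/integrableP: ig.
pose G := fine (\int[mu]_x (g x)%:E).
have GE : (\int[mu]_x (g x)%:E = G%:E)%E by rewrite fineK//; exact: integrable_fin_num.
have G0 : 0 <= G by rewrite fine_ge0//; apply: integral_ge0 => x _; rewrite lee_fin.
pose K := (Num.truncn (4 * M * (G + 1) / e)).+1.
have K0 : 0 < K%:R :> R by [].
have KM : 4 * M * (G + 1) / e < K%:R by rewrite real_truncnS_gt ?num_real.
pose t := 2 * M / K%:R.
have t0 : 0 < t by rewrite divr_gt0// mulr_gt0.
have tK : t * K%:R = 2 * M by rewrite /t -mulrA mulVf ?mulr1// gt_eqF.
have tG : t * G <= e / 2.
  rewrite /t mulrAC ler_pdivrMr//; rewrite ltr_pdivrMr// in KM.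
  by nra.
pose A (i : nat) : set T := [set x | t * i.+1%:R <= f x + M].
have mA i : measurable (A i).
  have -> : A i = setT `&` (fun x => f x + M) @^-1` `[t * i.+1%:R, +oo[%classic.
    by rewrite setTI; apply/seteqP; split=> x; rewrite /A/= in_itv/= andbT.
  by apply: measurable_funD.
pose e' := e / (4 * M).
have e'0 : 0 < e' by rewrite divr_gt0// mulr_gt0.
have tKe' : t * K%:R * e' = e / 2.
  by rewrite tK /e'; field; rewrite gt_eqF.
have hU i : exists kU : int * set T, Sg kU.1 kU.2 /\
    (weight mu g (sym_diff S (A i) kU.2) <= e'%:E)%E.
  by have [_ /(_ _ e'0)[k [U [SU wU]]]] := approxA (mA i); exists (k, U).
have [kU hkU] := choice hU.
pose U i := (kU i).2.
have SU i : Sg (kU i).1 (U i) by case: (hkU i).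
have wU i : (weight mu g (sym_diff S (A i) (U i)) <= e'%:E)%E by case: (hkU i).
have mU i : measurable (U i) by exact: Sg_measurable (SU i).
have mD i : measurable (sym_diff S (A i) (U i)) by exact: measurable_sym_diff.
have term0 i x : (0 <= (t * (\1_(sym_diff S (A i) (U i)) x * g x))%:E)%E.
  by rewrite lee_fin mulr_ge0 ?(ltW t0)// mulr_ge0// indicE.
have [k [ak mh bh]] := adapted_layers t (- M) K SU.
pose h (x : T) : R := - M + \sum_(i < K) t * \1_(U i) x.
rewrite -/h in ak mh; have {}bh : exists B, forall x, `|h x| <= B by [].
exists k, h; split=> //.
apply: (@le_trans _ _ (\int[mu]_x ((t * g x)%:E +
    \sum_(i < K) (t * (\1_(sym_diff S (A i) (U i)) x * g x))%:E))%E).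
  apply: ae_ge0_le_integral => //.
  - by move=> x _; rewrite lee_fin mulr_ge0.
  - apply/measurable_EFinP; apply: measurable_funM => //.
    by apply: measurableT_comp => //; exact: measurable_funB.
  - move=> x _; apply: adde_ge0; first by rewrite lee_fin mulr_ge0// ltW.
    by apply: sume_ge0 => i _; exact: term0.
  - apply: emeasurable_funD.
      by apply/measurable_EFinP; exact: measurable_funM.
    apply: emeasurable_sum => i; apply/measurable_EFinP; apply: measurable_funM => //.
    by apply: measurable_funM => //; exact: measurable_indic.
  have : {ae mu, forall x, S x}.
    by apply: negligibleS nullSC.
  apply: filterS2 fM => x fxM Sx _.
  rewrite sumEFin -EFinD lee_fin.
  under [X in _ <= _ + X]eq_bigr do rewrite mulrA.
  rewrite -mulr_suml -mulrDl ler_wpM2r//.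
  rewrite (_ : f x - h x = (f x + M - \sum_(i < K) t * (if t * i.+1%:R <= f x + M then 1 else 0))
     + \sum_(i < K) t * ((if t * i.+1%:R <= f x + M then 1 else 0) - \1_(U i) x)); last first.
    under [X in _ = _ + X]eq_bigr do rewrite mulrBr.
    by rewrite sumrB /h; ring.
  apply: le_trans (ler_normD _ _) _; rewrite lerD//.
    move: fxM; rewrite ler_norml => /andP[fx1 fx2].
    by apply: staircase => //; [lra|rewrite tK; lra].
  apply: le_trans (ler_norm_sum _ _ _) _; apply: ler_sum => i _.
  rewrite normrM gtr0_norm// ler_wpM2l ?(ltW t0)//.
  have [Ax|Ax] := pselect (A i x); have [Ux|Ux] := pselect (U i x).
  - by rewrite [X in X - _]ifT// [\1_(U i) x]indicE mem_set// subrr normr0.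
  - rewrite [X in X - _]ifT// !indicE memNset// mem_set ?subr0 ?normr1//.
    by split=> //; left.
  - rewrite [X in X - _]ifF; last exact/negP.
    rewrite !indicE mem_set// mem_set ?sub0r ?normrN ?normr1//.
    by split=> //; right.
  - rewrite [X in X - _]ifF; last exact/negP.
    by rewrite [\1_(U i) x]indicE memNset// subr0 normr0.
rewrite ge0_integralD//; first last.
- apply: emeasurable_sum => i; apply/measurable_EFinP; apply: measurable_funM => //.
  by apply: measurable_funM => //; exact: measurable_indic.
- by move=> x _; apply: sume_ge0 => i _; exact: term0.
- by apply/measurable_EFinP; exact: measurable_funM.
- by move=> x _; rewrite lee_fin mulr_ge0// ltW.
rewrite [e]splitr EFinD; apply: leeD.
  under eq_integral do rewrite EFinM.
  rewrite ge0_integralZl//; last 3 first.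
  - exact/measurable_EFinP.
  - by move=> x _; rewrite lee_fin.
  - by rewrite lee_fin ltW.
  by rewrite GE -EFinM lee_fin.
rewrite ge0_integral_sum//; last first.
- move=> i; apply/measurable_EFinP; apply: measurable_funM => //.
  by apply: measurable_funM => //; exact: measurable_indic.
apply: (@le_trans _ _ (\sum_(i < K) (t * e')%:E)%E).
  apply: lee_sum => i _; under eq_integral do rewrite EFinM.
  rewrite ge0_integralZl//; last 3 first.
  - apply/measurable_EFinP; apply: measurable_funM => //; exact: measurable_indic.
  - by move=> x _; rewrite lee_fin mulr_ge0// indicE.
  - by rewrite lee_fin ltW.
  rewrite integral_indic_weight// [leRHS]EFinM; apply: lee_wpmul2l; last exact: wU.
  by rewrite lee_fin ltW.
rewrite sumEFin lee_fin sumr_const card_ord -[leLHS]mulr_natr.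
by rewrite -tKe' mulrAC.
Qed.

End function_approximation.

Section bounded_functions.
Context d (T : measurableType d) (R : realType).
Variable mu : {measure set T -> \bar R}.

Lemma bounded_Lfun_pinfty (h : T -> R) (B : R) : measurable_fun setT h ->
  (forall x, `|h x| <= B) -> h \in Lfun mu +oo%E.
Proof.
move=> mh hB; rewrite inE; apply/andP; split; rewrite inE//=.
rewrite /finite_norm unlock; case: ifPn => // _.
apply: (@le_lt_trans _ _ B%:E); last exact: ltry.
by apply/ess_supP; apply: nearW => x /=; rewrite lee_fin.
Qed.

Lemma Lfun_pinfty_bounded (f : T -> R) : finite_norm mu +oo%E f ->
  exists2 M : R, 0 < M & {ae mu, forall x, `|f x| <= M}.
Proof.
rewrite /finite_norm unlock; case: ifPn => [_ h|mu0 _].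
  have [M hM] := @ess_supr_bounded _ _ _ mu (Num.norm \o f) h.
  exists (Num.max M 1); first by rewrite lt_max ltr01 orbT.
  by apply: filterS hM => x xM; rewrite le_max xM.
(* Here [mu] is zero and the norm carries no information, but the whole space is null. *)
exists 1 => //; exists setT; split=> //.
by apply/eqP; rewrite -measure_le0 leNgt.
Qed.

Lemma bounded_mul_integrable (f g : T -> R) (M : R) : measurable_fun setT f ->
  {ae mu, forall x, `|f x| <= M} -> 0 < M -> mu.-integrable setT (EFin \o g) ->
  mu.-integrable setT (EFin \o (fun x => f x * g x)).
Proof.
move=> mf fM M0 ig.
have mg : measurable_fun setT g by apply/measurable_EFinP; case/integrableP: ig.
apply/integrableP; split; first by apply/measurable_EFinP; exact: measurable_funM.
have /integrableP[_] := integrableZl measurableT M ig.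
apply: le_lt_trans; apply: ae_ge0_le_integral => //.
- by apply: measurableT_comp => //; apply/measurable_EFinP; exact: measurable_funM.
- by apply: measurableT_comp => //; apply: measurable_funeM; exact/measurable_EFinP.
- apply: filterS fM => x fx _ /=; rewrite lee_fin !normrM ler_wpM2r//.
  by rewrite (gtr0_norm M0).
Qed.

Lemma Rintegral_mul_diff_lt (f h g : T -> R) (M B e : R) :
  measurable_fun setT f -> {ae mu, forall x, `|f x| <= M} -> 0 < M ->
  measurable_fun setT h -> {ae mu, forall x, `|h x| <= B} -> 0 < B ->
  mu.-integrable setT (EFin \o g) ->
  (\int[mu]_x (`|f x - h x| * `|g x|)%:E < e%:E)%E ->
  `|\int[mu]_x (f x * g x) - \int[mu]_x (h x * g x)| < e.
Proof.
move=> mf fM M0 mh hB B0 ig fhe.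
have ifg := bounded_mul_integrable mf fM M0 ig.
have ihg := bounded_mul_integrable mh hB B0 ig.
rewrite -RintegralB//.
have idiff : mu.-integrable setT (EFin \o (fun x => f x * g x - h x * g x)).
  rewrite (_ : _ \o _ = ((EFin \o (fun x => f x * g x)%R) \- (EFin \o (fun x => h x * g x)%R))%E).
    exact: integrableB.
  by apply/funext => x /=; rewrite EFinB.
apply: le_lt_trans (le_normr_Rintegral _ idiff) _ => //.
rewrite -lte_fin /Rintegral fineK; last first.
  by apply: integrable_fin_num => //; exact: integrable_norm idiff.
apply: le_lt_trans fhe; rewrite le_eqVlt; apply/orP; left; apply/eqP.
by apply: eq_integral => x _ /=; rewrite -mulrBl normrM.
Qed.

End bounded_functions.

Section weak_star_density.
Context {R : realType} {d : nat}.
Variable mu : {measure set (Rd R d) -> \bar R}.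
Hypothesis msupp : measurable (supp mu).
Hypothesis null_setC_supp : mu.-negligible (~` supp mu).
Variable Sg : int -> set (set (Rd R d)).
Hypothesis Sg_sigma : forall k, sub_sigma_algebra_supp mu (Sg k).
Hypothesis Sg_mono : forall j k : int, j <= k -> Sg j `<=` Sg k.
Hypothesis approxA : forall g : Rd R d -> R, mu.-integrable setT (EFin \o g) ->
  (forall x, 0 <= g x) -> forall A, measurable A -> approximable mu (supp mu) Sg g A.

Lemma Linf_approx (f : Linf mu) (g : Rd R d -> R) (e : R) :
  mu.-integrable setT (EFin \o g) -> (forall x, 0 <= g x) -> 0 < e ->
  exists h : Linf mu, (\bigcup_(k : int) Linf_sub mu (Sg k)) h /\
    (\int[mu]_x (`|f x - h x| * g x)%:E < e%:E)%E.
Proof.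
move=> ig g0 e0.
have [M M0 fM] := Lfun_pinfty_bounded (Lfunction_finite _ f).
have e20 : 0 < e / 2 by rewrite divr_gt0.
have mf : measurable_fun setT f by [].
have [|||k [h [ah mh [B hB] fh]]] := function_approx msupp null_setC_supp
    (Sg := Sg) _ _ _ Sg_mono ig g0 (approxA ig g0) mf fM M0 e20.
- by move=> k; case: (Sg_sigma k).
- by move=> k; case: (Sg_sigma k).
- by move=> k; case: (Sg_sigma k).
have hL := bounded_Lfun_pinfty mu mh hB.
exists (Lfun_Sub (leey _) hL); split.
  by exists k => // B' _; exact: ah.
by apply: le_lt_trans fh _; rewrite lte_fin; lra.
Qed.

(** A weak-* neighborhood tests finitely many functions, but sums of nonnegative weights merge the
    tests into one. So the sets [V] of elements of the union close to [f0] in a weighted L1 norm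
    form a filter basis. That filter converges to [f0] when tested against any [g], by using the
    weight |g|, and [Linf_approx] shows that its basic sets are inhabited. *)
Theorem dense_Linf_sub : dense (\bigcup_(k : int) Linf_sub mu (Sg k)).
Proof.
move=> O [+ +] [W oW WO] => f0' Of0; pose f0 : Linf mu := f0'.
pose DD : set ((Rd R d -> R) * R) := [set p : (Rd R d -> R) * R | [/\ mu.-integrable setT (EFin \o p.1),
  forall x, 0 <= p.1 x & 0 < p.2]].
pose V (p : (Rd R d -> R) * R) : set (Linf mu) :=
  [set h | (\bigcup_(k : int) Linf_sub mu (Sg k)) h /\
    (\int[mu]_x (`|f0 x - h x| * p.1 x)%:E < p.2%:E)%E].
pose F := filter_from DD V.
have FF : Filter F.
  apply: filter_from_filter.
    exists (cst 0, 1); split=> //=; exact: integrable0.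
  move=> [g1 e1] [g2 e2] [/= ig1 g10 e10] [/= ig2 g20 e20].
  exists (fun x => g1 x + g2 x, Num.min e1 e2).
    split=> /=; [|by move=> x; exact: addr_ge0|by rewrite lt_min e10].
    rewrite (_ : _ \o _ = ((EFin \o g1) \+ (EFin \o g2))%E); first exact: integrableD.
    by apply/funext => x.
  move=> h [uh]; rewrite /= EFin_min lt_min => /andP[h1 h2].
  have m1 : measurable_fun setT g1 by apply/measurable_EFinP; case/integrableP: ig1.
  have m2 : measurable_fun setT g2 by apply/measurable_EFinP; case/integrableP: ig2.
  have mfh : measurable_fun setT (fun x => `|f0 x - h x|).
    by apply: measurableT_comp => //; exact: measurable_funB.
  (split; split=> //=); [apply: le_lt_trans h1|apply: le_lt_trans h2].
    apply: ge0_le_integral => //.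
    - by move=> x _; rewrite lee_fin mulr_ge0.
    - by apply/measurable_EFinP; exact: measurable_funM.
    - by apply/measurable_EFinP; apply: measurable_funM => //; exact: measurable_funD.
    - by move=> x _; rewrite lee_fin ler_wpM2l// lerDl.
  apply: ge0_le_integral => //.
  - by move=> x _; rewrite lee_fin mulr_ge0.
  - by apply/measurable_EFinP; exact: measurable_funM.
  - by apply/measurable_EFinP; apply: measurable_funM => //; exact: measurable_funD.
  - by move=> x _; rewrite lee_fin ler_wpM2l// lerDr.
(* The domain gets the discrete topology because pointwise convergence does not see the one it
   carries. *)
have cvF : {ptws, (fmap (@pairing R d mu) F
    : set_system {ptws (discrete_topology (L1 mu)) -> R}) --> pairing f0}.
  apply/(@pointwise_cvgP (discrete_topology (L1 mu)) R) => g; apply/cvgrPdist_lt => e e0.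
  have ig : mu.-integrable setT (EFin \o (g : Rd R d -> R)).
    by apply/Lfun1_integrable; exact: LfunP.
  exists (Num.norm \o g, e).
    by split=> //=; exact: integrable_norm.
  move=> h [uh /= hlt].
  have [M M0 fM] := Lfun_pinfty_bounded (Lfunction_finite _ f0).
  have [B B0 hB] := Lfun_pinfty_bounded (Lfunction_finite _ h).
  exact: (Rintegral_mul_diff_lt _ fM M0 _ hB B0 ig hlt).
have nW : nbhs (pairing f0 : {ptws (discrete_topology (L1 mu)) -> R}) W.
  by apply: open_nbhs_nbhs; split=> //; rewrite -WO in Of0.
have [[g e] [ig g0 e0] sub] := cvF _ nW.
have [h [uh hlt]] := Linf_approx f0 ig g0 e0.
by exists h; split=> //; rewrite -WO; apply: sub; split.
Qed.

End weak_star_density.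

(** * Filtration by doubling cubes *)

Section lattice.
Context {R : realType} {d : nat} {n : R}.
Variable mu : {measure set (Rd R d) -> \bar R}.
Hypothesis mu_growth : polynomial_growth mu n.
Variable beta : R.
Hypothesis n_gt0 : 0 < n.
Hypothesis beta_n : 2 * ratio `^ n <= beta.
Hypothesis beta_d : 2 * ratio ^+ d <= beta.
Implicit Types (x y v w : 'rV[R]_d) (k j i l : int).

Local Notation mass := (mass mu).

Definition good_ball k w : Prop :=
  mass w (200 * (200 * rho k)) <= beta * mass w (200 * rho k).

Local Notation rad := (rad good_ball).

Variables (Z : int -> set 'rV[R]_d) (lab : int -> 'rV[R]_d -> 'rV[R]_d).
Hypothesis ZS : forall k, Z k `<=` supp mu.
Hypothesis lab_Z : forall k x, supp mu x -> Z k (lab k x).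
Hypothesis lab_dist : forall k x, supp mu x ->
  eucl_dist x (lab k x) < 6 * rad k (lab k x).
Hypothesis countZ : forall k, countable (Z k).
Hypothesis lab_ball : forall k w x, Z k w -> supp mu x ->
  eucl_dist x w < rad k w -> lab k x = w.
Hypothesis lab_nest : forall k x y, supp mu x -> supp mu y ->
  lab (k + 1) x = lab (k + 1) y -> lab k x = lab k y.
Hypothesis lab_step : forall k x, supp mu x ->
  eucl_dist (lab (k + 1) x) (lab k x) < 4 * rad k (lab k x).

(** * Decay of mass along branches without good cubes *)

Definition lab_good k x : Prop := good_ball k (lab k x).
Definition lab_rad k x : R := rad k (lab k x).
Definition lab_mass k x : R := mass (lab k x) (200 * lab_rad k x).

Lemma beta_gt0 : 0 < beta.
Proof. by apply: lt_le_trans beta_n; rewrite mulr_gt0// powR_gt0// ratio_gt0. Qed.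

Lemma lab_rad_gt0 k x : 0 < lab_rad k x.
Proof. exact: rad_gt0. Qed.

Lemma lab_rad_ge k x : rho k <= lab_rad k x.
Proof. exact: rad_ge. Qed.

Lemma lab_rad_le k x : lab_rad k x <= 200 * rho k.
Proof. exact: rad_le. Qed.

Lemma lab_mass_gt0 k x : supp mu x -> 0 < lab_mass k x.
Proof.
move=> Sx; apply: (mass_gt0 mu_growth); first exact/ZS/lab_Z.
by have := lab_rad_gt0 k x; lra.
Qed.

Lemma mass_rho_le w k r : r <= 200 * (200 * rho k) -> mass w r <= rho (k - 1) `^ n.
Proof.
have rp := rho_gt0 (R := R) (k - 1); have := rhoS (R := R) (k - 1); rewrite subrK => <- rk.
apply: le_trans (mass_le mu_growth w rp).
by apply: (le_mass mu_growth); rewrite eucl_distxx add0r.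
Qed.

Lemma lab_mass_le k x : lab_mass k x <= rho (k - 1) `^ n.
Proof. by apply: mass_rho_le; have := lab_rad_le k x; lra. Qed.

(** At a level that is not good, [lab_mass] is the mass of the ball of radius [200 * rho (k + 1)].
    Failure of doubling compares it with the ball of radius [rho k], which lies in 200 times the
    ball of level [k]. *)
Lemma lab_mass_decay k x : supp mu x -> ~ lab_good (k + 1) x ->
  beta * lab_mass (k + 1) x <= lab_mass k x.
Proof.
move=> Sx bad; have := bad; rewrite /lab_good /good_ball => /negP; rewrite -ltNge.
rewrite /lab_mass {1}/lab_rad (rad_bad (good := good_ball) bad) -rhoS => /ltW/le_trans; apply.
apply: (le_mass mu_growth); rewrite eucl_distC.
by have := lab_step k Sx; have := @rho_gt0 R k; have := lab_rad_ge k x; rewrite /lab_rad; lra.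
Qed.

Lemma lab_mass_decay_iter k (s : nat) x : supp mu x ->
  (forall i, k < i -> i <= k + s%:Z -> ~ lab_good i x) ->
  beta ^+ s * lab_mass (k + s%:Z) x <= lab_mass k x.
Proof.
move=> Sx; elim: s => [|s ih] h; first by rewrite addr0 expr0 mul1r.
apply: le_trans (ih _); last by move=> i ki is_; apply: h => //; lia.
rewrite exprSr -mulrA ler_wpM2l ?exprn_ge0 ?(ltW beta_gt0)//.
rewrite (_ : k + s.+1%:Z = k + s%:Z + 1); last by lia.
by apply: lab_mass_decay => //; apply: h; lia.
Qed.

(** Without good levels up to [k], s steps of decay from level k - s, where growth bounds the mass
    by rho(k-1)^n ratio^(ns), give 2^s [lab_mass k x] <= rho(k-1)^n for every s. This contradicts
    the positive mass of balls centered on the support. *)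
Lemma exists_good_above k x : supp mu x -> exists2 j, j <= k & lab_good j x.
Proof.
move=> Sx; apply: contrapT => h.
have key (s : nat) : 2 ^+ s * lab_mass k x <= rho (k - 1) `^ n.
  have := @lab_mass_decay_iter (k - s%:Z) s x Sx.
  rewrite subrK => /(_ _)/wrap[i _ ik gi|]; first by apply: h; exists i.
  have := lab_mass_le (k - s%:Z) x.
  rewrite (_ : k - s%:Z - 1 = k - 1 - s%:Z); last by lia.
  rewrite rho_sub powRM ?exprn_ge0 ?(ltW (rho_gt0 _)) ?(ltW ratio_gt0)//.
  rewrite -powR_mulrn ?(ltW ratio_gt0)// -powRrM (mulrC _ n) powRrM powR_mulrn ?powR_ge0//.
  have rn0 : 0 < (ratio : R) `^ n by rewrite powR_gt0// ratio_gt0.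
  have bs : (2 * ratio `^ n) ^+ s <= beta ^+ s.
    by apply: lerXn2r beta_n; rewrite ?nnegrE ?(ltW beta_gt0)// mulr_ge0// ltW.
  move=> h1 h2; rewrite -(@ler_pM2r _ ((ratio `^ n) ^+ s)) ?exprn_gt0//.
  apply: le_trans h1; apply: le_trans h2.
  by rewrite mulrAC -exprMn ler_wpM2r// ltW// lab_mass_gt0.
have m0 := lab_mass_gt0 k Sx.
pose s := (Num.truncn (rho (k - 1) `^ n / lab_mass k x)).+1.
have := key s; rewrite -ler_pdivlMr// leNgt => /negP; apply.
apply: (@lt_le_trans _ _ s%:R); first by rewrite real_truncnS_gt ?num_real.
by rewrite -natrX ler_nat ltnW// ltn_expl.
Qed.

Lemma mass_le_lab_mass k x : supp mu x -> mass x (rho k) <= lab_mass k x.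
Proof.
move=> Sx; apply: (le_mass mu_growth); rewrite eucl_distC.
by have := lab_dist k Sx; have := lab_rad_ge k x; rewrite -/(lab_rad k x); have := lab_rad_gt0 k x; lra.
Qed.

(** At a point with no good level finer than [k], the ball of radius rho(k+s) has mass at most
    rho(k-1)^n / beta^s. Since beta is at least 2 ratio^d, [negligible_thin] applies. *)
Lemma exists_null_not_good : exists N : set (Rd R d),
  [/\ measurable N, mu N = 0, N `<=` supp mu &
    forall x k, supp mu x -> ~ N x -> exists2 j, k <= j & lab_good j x].
Proof.
pose B k : set (Rd R d) := [set x | supp mu x /\ forall j, k < j -> ~ lab_good j x].
have nB k : mu.-negligible (B k).
  apply: (@negligible_thin _ _ n mu mu_growth _ (rho k) (rho (k - 1) `^ n) beta) => //.
    exact: rho_gt0.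
  move=> x [Sx bad] s; rewrite -rho_add; apply: le_trans (mass_le_lab_mass _ Sx) _.
  rewrite ler_pdivlMr ?exprn_gt0 ?beta_gt0// mulrC.
  apply: le_trans (lab_mass_le k x); apply: lab_mass_decay_iter => // i ki _.
  exact: bad.
have : mu.-negligible (\bigcup_(k in [set: int]) B k).
  apply: (@bigcup_countable_closed _ _ (fun A => mu.-negligible A)) => //.
  - exact: negligible_set0.
  - exact: negligible_bigcup.
move=> [N [mN N0 BN]]; exists (N `&` supp mu); split.
- by apply: measurableI => //; exact: measurable_supp mu_growth.
- apply/eqP; rewrite -measure_le0 -N0 le_measure ?inE//.
  by apply: measurableI => //; exact: measurable_supp mu_growth.
- by move=> x [].
- move=> x k Sx nN; apply: contrapT => h; apply: nN; split=> //; apply: BN.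
  exists (k - 1) => //; split=> // j kj gj; apply: h; exists j => //; lia.
Qed.

Let msupp : measurable (supp mu).
Proof. exact: measurable_supp mu_growth. Qed.

Let null_setC_supp : mu.-negligible (~` supp mu).
Proof. exact: negligible_setC_supp. Qed.

(** * Cubes and their versions without the exceptional null set *)

Definition cube_at k w : set (Rd R d) := [set x | supp mu x /\ lab k x = w].

Hypothesis mcube : forall k w, measurable (cube_at k w).
Variable N : set (Rd R d).
Hypothesis mN : measurable N.
Hypothesis N0 : mu N = 0.
Hypothesis good_below : forall x k, supp mu x -> ~ N x ->
  exists2 j, k <= j & lab_good j x.

Lemma lab_mono j k x y : j <= k -> supp mu x -> supp mu y ->
  lab k x = lab k y -> lab j x = lab j y.
Proof.
move=> jk Sx Sy; have -> : k = j + (`|k - j|%N)%:Z by lia.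
elim: `|k - j|%N => [|s ih]; first by rewrite addr0.
rewrite (_ : j + s.+1%:Z = j + s%:Z + 1); last by lia.
by move=> /(lab_nest Sx Sy).
Qed.

Lemma cube_sub j k x y : j <= k -> cube_at k (lab k x) y -> supp mu x ->
  cube_at k (lab k x) `<=` cube_at j (lab j y).
Proof.
move=> jk [Sy yx] Sx z [Sz zx]; split=> //; apply: (lab_mono jk Sz Sy).
by rewrite zx.
Qed.

(* Only a cube filling the whole support keeps the points of [N]: then the
   intersection of an empty family of ancestors, which is [supp], is an atom. *)
Definition piece k w : set (Rd R d) :=
  if `[< cube_at k w = supp mu >] then supp mu else cube_at k w `\` N.

Lemma piece_sub k w : piece k w `<=` cube_at k w.
Proof. by rewrite /piece; case: asboolP => [<-//|_ x []]. Qed.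

Lemma sub_piece k w : cube_at k w `\` N `<=` piece k w.
Proof. by rewrite /piece; case: asboolP => [-> x []|_]. Qed.

Lemma piece_notN k w x : piece k w x -> cube_at k w <> supp mu -> ~ N x.
Proof. by rewrite /piece; case: asboolP => // _ []. Qed.

Lemma measurable_piece k w : measurable (piece k w).
Proof. by rewrite /piece; case: asboolP => // _; exact: measurableD. Qed.

Lemma piece_mem k x : supp mu x -> ~ N x -> piece k (lab k x) x.
Proof. by move=> Sx nN; apply: sub_piece. Qed.

Lemma negligible_N : mu.-negligible N.
Proof. exact/negligibleP. Qed.

Lemma ball_ae_sub_piece k w : Z k w ->
  ae_subset mu (eucl_ball w (rad k w)) (piece k w).
Proof.
move=> Zw; apply: negligibleS (negligibleU null_setC_supp negligible_N).
move=> x [xw np]; have [Sx|] := pselect (supp mu x); last by left.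
right; apply: contrapT => nN; apply: np; apply: sub_piece; split=> //.
by split=> //; apply: lab_ball => //; rewrite eucl_distC.
Qed.

Lemma piece_nonnull k w : Z k w -> ~ mu.-negligible (piece k w).
Proof.
move=> Zw nu; have r0 := rad_gt0 good_ball k w.
have := ZS Zw r0; rewrite lt_neqAle eq_sym => /andP[/eqP + _]; apply.
apply/negligibleP; first exact: measurable_eucl_ball.
apply: negligibleS (negligibleU (ball_ae_sub_piece Zw) nu) => x xw.
by have [|] := pselect (piece k w x); [right|left].
Qed.

Lemma piece_inhabited k w : Z k w -> exists x, [/\ supp mu x, ~ N x & lab k x = w].
Proof.
move=> Zw; apply: contrapT => h; apply: (piece_nonnull Zw).
apply: negligibleS negligible_N => x /piece_sub[Sx xw].
by apply: contrapT => nN; apply: h; exists x.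
Qed.

(** * Maximal good cubes and the filtration they generate *)

Definition first_good k j x :=
  [/\ k <= j, lab_good j x & forall i, k <= i -> i < j -> ~ lab_good i x].

Definition maximal_pieces k : set (set (Rd R d)) :=
  [set A | exists x j, [/\ supp mu x, ~ N x, first_good k j x & A = piece j (lab j x)]].

Definition good_pieces : set (set (Rd R d)) :=
  [set A | exists x j, [/\ supp mu x, ~ N x, lab_good j x & A = piece j (lab j x)]].

Lemma first_good_exists k x : supp mu x -> ~ N x -> exists j, first_good k j x.
Proof.
move=> Sx nN; have [j kj Gj] := good_below k Sx nN.
have ex : exists s : nat, `[< lab_good (k + s%:Z) x >].
  exists `|j - k|%N; apply/asboolP.
  by rewrite (_ : k + (`|j - k|%N)%:Z = j)//; lia.
have [s /asboolP Gs smin] := ex_minnP ex.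
exists (k + s%:Z); split=> //; first by lia.
move=> i ki is_ Gi; have := smin `|i - k|%N.
rewrite (_ : k + (`|i - k|%N)%:Z = i); last by lia.
by move=> /(_ (asboolT Gi)); lia.
Qed.

(** Two cubes with a common point [z] lie on the branch of [z]. The coarser one is then good on both
    branches, so the finer level could not be the first. *)
Lemma first_good_eq k i j x y z : supp mu x -> supp mu y -> supp mu z ->
  first_good k j x -> first_good k i y ->
  lab j z = lab j x -> lab i z = lab i y -> i = j.
Proof.
move=> Sx Sy Sz [kj Gj fj] [ki Gi fi] zx zy; apply/eqP; rewrite eq_le.
apply/andP; split; rewrite leNgt; apply/negP => h.
- by apply: (fi j) => //; rewrite /lab_good -(lab_mono (ltW h) Sz Sy zy) zx.
- by apply: (fj i) => //; rewrite /lab_good -(lab_mono (ltW h) Sz Sx zx) zy.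
Qed.

Lemma maximal_pieces_disjoint k : trivIset (maximal_pieces k) id.
Proof.
move=> A B [x [j [Sx Nx fj ->]]] [y [i [Sy Ny fi ->]]] /= [z [/piece_sub[Sz zx] /piece_sub[_ zy]]].
have ij := first_good_eq Sx Sy Sz fj fi zx zy; subst i.
by rewrite -zx -zy.
Qed.

Lemma maximal_pieces_cover k x : supp mu x -> ~ N x ->
  exists2 A, maximal_pieces k A & A x.
Proof.
move=> Sx Nx; have [j fj] := first_good_exists k Sx Nx.
exists (piece j (lab j x)); last exact: piece_mem.
by exists x, j.
Qed.

Lemma maximal_pieces_supp k A : maximal_pieces k A -> A `<=` supp mu.
Proof. by move=> [x [j [_ _ _ ->]]] y /piece_sub[]. Qed.

Lemma maximal_pieces_measurable k A : maximal_pieces k A -> measurable A.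
Proof. by move=> [x [j [_ _ _ ->]]]; exact: measurable_piece. Qed.

Lemma maximal_pieces_nonnull k A : maximal_pieces k A -> ~ mu.-negligible A.
Proof. by move=> [x [j [Sx _ _ ->]]]; apply: piece_nonnull; exact: lab_Z. Qed.

Lemma maximal_pieces_ae_cover k :
  ae_subset mu (supp mu) (\bigcup_(Q in maximal_pieces k) Q).
Proof.
apply: negligibleS negligible_N => x [Sx h]; apply: contrapT => Nx; apply: h.
by have [A] := maximal_pieces_cover k Sx Nx; exists A.
Qed.

Lemma maximal_pieces_countable k : countable (maximal_pieces k).
Proof.
apply: (@sub_countable _ _ _ (\bigcup_(j in [set: int]) (piece j @` Z j))).
  apply: subset_card_le => A [x [j [Sx _ _ ->]]]; exists j => //.
  by exists (lab j x) => //; exact: lab_Z.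
apply: bigcup_countable => // j _; apply: sub_countable (countZ j).
exact: card_image_le.
Qed.

Definition filtr k : set (set (Rd R d)) := <<s supp mu, maximal_pieces k >>.

Lemma filtr_sub_sigma_algebra k : sub_sigma_algebra_supp mu (filtr k).
Proof.
apply: sub_sigma_algebra_generated => //; last exact: maximal_pieces_measurable.
exact: maximal_pieces_supp.
Qed.

Lemma atoms_filtr k : atoms mu (filtr k) = maximal_pieces k.
Proof.
apply: atoms_generated => //.
- exact: maximal_pieces_supp.
- exact: maximal_pieces_measurable.
- exact: maximal_pieces_nonnull.
- exact: maximal_pieces_disjoint.
- exact: maximal_pieces_ae_cover.
Qed.

Lemma filtr_atomic k : atomic mu (filtr k).
Proof.
apply: atomic_generated => //.
- exact: maximal_pieces_supp.
- exact: maximal_pieces_measurable.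
- exact: maximal_pieces_nonnull.
- exact: maximal_pieces_disjoint.
- exact: maximal_pieces_ae_cover.
Qed.

Lemma filtration_atoms_filtr : filtration_atoms mu filtr = good_pieces.
Proof.
rewrite /filtration_atoms; apply/seteqP; split=> A.
  by move=> [k _]; rewrite atoms_filtr => -[x [j [Sx Nx [_ Gj _] ->]]]; exists x, j.
move=> [x [j [Sx Nx Gj ->]]]; exists j => //; rewrite atoms_filtr.
exists x, j; split=> //; split=> // i ji ij.
by exfalso; have := lt_le_trans ij ji; rewrite ltxx.
Qed.

Lemma filtr_supp k : filtr k (supp mu).
Proof.
have [s0 sD _] := @smallest_sigma_algebra _ (supp mu) (maximal_pieces k).
by rewrite -[supp mu]setD0; apply: sD.
Qed.

Lemma filtr_bigcup k (D : set (set (Rd R d))) :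
  D `<=` maximal_pieces k -> filtr k (\bigcup_(A in D) A).
Proof.
move=> DA; have [s0 sD sU] := @smallest_sigma_algebra _ (supp mu) (maximal_pieces k).
apply: bigcup_countable_closed => //.
- by apply: sub_countable (maximal_pieces_countable k); exact: subset_card_le.
- by move=> A /DA; exact: sub_gen_smallest.
Qed.

(** An atom of level at least [k + 1] is still maximal from [k + 1] on. An atom of level [k] is the
    whole support or the union of the countably many next atoms that it contains. *)
Lemma filtr_nested k : filtr k `<=` filtr (k + 1).
Proof.
apply: smallest_sub; first exact: smallest_sigma_algebra.
move=> A [x [j [Sx Nx [kj Gj fj] ->]]].
have [kj1|jk] := leP (k + 1) j.
  apply: sub_gen_smallest; exists x, j; split=> //; split=> // i ki ij.
  by apply: fj => //; lia.
have {jk} jk : j = k by lia.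
subst j; rewrite /piece; case: asboolP => [_|nS]; first exact: filtr_supp.
have -> : cube_at k (lab k x) `\` N =
    \bigcup_(B in maximal_pieces (k + 1) `&` [set B | B `<=` cube_at k (lab k x) `\` N]) B.
  apply/seteqP; split=> [y [[Sy yx] Ny]|y [B [_ Bs] /Bs//]].
  have [B mB By] := maximal_pieces_cover (k + 1) Sy Ny; exists B => //; split=> //.
  move: mB By => [u [j [Su Nu [kj1 Gj1 _] ->]]] py z pz.
  have [_ yu] := piece_sub py.
  have kj' : k <= j by lia.
  have sub : cube_at j (lab j u) `<=` cube_at k (lab k x).
    by rewrite -yx; apply: cube_sub => //; exact: piece_sub py.
  split; first exact/sub/piece_sub.
  (* A finer piece keeps points of [N] only if its cube is the whole support, and then so is the
     cube around it. *)
  apply: piece_notN pz _ => eS; apply: nS; apply/seteqP; split=> [t []//|].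
  by rewrite -eS.
by apply: filtr_bigcup => B [].
Qed.

(* Two cubes are nested or disjoint, and a nonempty difference of cubes contains
   a cube, hence is not null. *)
Lemma cube_ae_sub j k x y : supp mu x -> supp mu y ->
  ae_subset mu (cube_at j (lab j x)) (cube_at k (lab k y)) -> 
  cube_at j (lab j x) `<=` cube_at k (lab k y).
Proof.
move=> Sx Sy h; have [jk|kj] := leP k j.
  have [t [St Nt tx]] := piece_inhabited (lab_Z j Sx).
  have [ty|nty] := pselect (lab k t = lab k y).
    move=> z [Sz zx]; split=> //; rewrite -ty; apply: (lab_mono jk Sz St).
    by rewrite zx tx.
  exfalso; apply: (piece_nonnull (lab_Z j Sx)).
  apply: negligibleS h => z /piece_sub [Sz zx]; split=> // -[_ zy].
  by apply: nty; rewrite -zy; apply: (lab_mono jk St Sz); rewrite zx.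
move=> z [Sz zx]; split=> //; apply: contrapT => nzy.
apply: (piece_nonnull (lab_Z k Sz)); apply: negligibleS h => t /piece_sub[St tz].
split; last by move=> [_ ty]; apply: nzy; rewrite -tz.
by split=> //; rewrite -zx; apply: (lab_mono (ltW kj) St Sz).
Qed.

Lemma piece_ae_sub_cube j k x y : supp mu x -> supp mu y ->
  ae_subset mu (piece j (lab j x)) (piece k (lab k y)) ->
  cube_at j (lab j x) `<=` cube_at k (lab k y).
Proof.
move=> Sx Sy h; apply: cube_ae_sub => //.
apply: negligibleS (negligibleU h negligible_N) => t [tx nty].
have [Nt|Nt] := pselect (N t); first by right.
by left; split; [exact: sub_piece|move=> /piece_sub].
Qed.

Lemma cube_center k x : supp mu x -> cube_at k (lab k x) (lab k x).
Proof.
move=> Sx; have Zx := lab_Z k Sx; split; first exact: ZS Zx.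
by apply: lab_ball => //; [exact: ZS Zx|rewrite eucl_distxx rad_gt0].
Qed.

Lemma cube_dist k x y : cube_at k (lab k x) y ->
  eucl_dist y (lab k x) < 6 * rad k (lab k x).
Proof. by move=> [Sy <-]; exact: lab_dist. Qed.

(* A bounded cube that never grows contains balls of arbitrarily large radius
   centered at its points, hence is everything. *)
Lemma exists_larger_good k x : supp mu x -> cube_at k (lab k x) <> supp mu ->
  exists j, [/\ j < k, lab_good j x & cube_at j (lab j x) <> cube_at k (lab k x)].
Proof.
move=> Sx nS; apply: contrapT => h; apply: nS; apply/seteqP; split=> [t []//|y Sy].
have [M hM] := @rho_large R (eucl_dist y (lab k x) + 6 * rad k (lab k x)).
have [j jM Gj] := exists_good_above (Num.min M (k - 1)) Sx.
have jk : j < k by lia.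
have jM' : j <= M by lia.
have cc : cube_at j (lab j x) = cube_at k (lab k x).
  by apply: contrapT => nc; apply: h; exists j.
have := cube_center j Sx; rewrite cc => /cube_dist cd.
rewrite -cc; split=> //; apply: lab_ball => //; first exact: lab_Z.
have := hM j jM'; have := rad_ge lab_good j x.
have := eucl_dist_triangle (lab k x) y (lab j x).
by rewrite (eucl_distC (lab k x)); lra.
Qed.

(** * Parents of atoms *)

Lemma parent_supp Q : good_pieces Q -> Q = supp mu -> parent mu filtr Q = supp mu.
Proof.
move=> gQ QS; rewrite /parent; apply/seteqP; split=> [t []//|t St]; split=> //.
move=> A [fA [_ h]]; exfalso; apply: h.
apply: negligibleS (@negligible_set0 _ _ _ mu) => u [Au].
rewrite QS; apply; move: fA Au; rewrite filtration_atoms_filtr => -[v [i [_ _ _ ->]]].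
by move=> /piece_sub[].
Qed.

(** [j] is the finest good level before [k] whose cube is a different set. Good levels in between
    have the same cube and so give no strictly larger atom; every strictly larger atom belongs to
    the branch of [x] at a level at most [j], hence contains the piece of level [j]. *)
Lemma parent_piece k x : supp mu x -> ~ N x -> lab_good k x ->
  cube_at k (lab k x) <> supp mu ->
  exists j, [/\ j < k, lab_good j x,
    parent mu filtr (piece k (lab k x)) = piece j (lab j x) &
    forall i, j < i -> i < k -> lab_good i x ->
      cube_at i (lab i x) = cube_at k (lab k x)].
Proof.
move=> Sx Nx Gk nS; have [j0 [j0k Gj0 nj0]] := exists_larger_good Sx nS.
pose P (s : nat) := `[< lab_good (k - s.+1%:Z) x /\
   cube_at (k - s.+1%:Z) (lab (k - s.+1%:Z) x) <> cube_at k (lab k x) >].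
have ex : exists s, P s.
  exists `|(k - j0 - 1)%R|%N; apply/asboolP.
  by rewrite (_ : k - (`|(k - j0 - 1)%R|%N).+1%:Z = j0)//; lia.
have [s /asboolP + smin] := ex_minnP ex; set j := k - s.+1%:Z => -[Gj nj].
have jk : j < k by rewrite /j; lia.
have jmax i : j < i -> i < k -> lab_good i x ->
    cube_at i (lab i x) = cube_at k (lab k x).
  move=> ji ik Gi; apply: contrapT => ni; have := smin `|(k - i - 1)%R|%N.
  have -> : P `|(k - i - 1)%R|%N.
    by apply/asboolP; rewrite (_ : k - (`|(k - i - 1)%R|%N).+1%:Z = i)//; lia.
  by move=> /(_ isT); rewrite /j in ji *; lia.
exists j; split=> //.
have ckj : cube_at k (lab k x) `<=` cube_at j (lab j x) by apply: cube_sub => //; exact: ltW.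
have ae_eq i : i <= k ->
   ae_subset mu (piece i (lab i x)) (piece k (lab k x)) -> cube_at i (lab i x) = cube_at k (lab k x).
  move=> ik /piece_ae_sub_cube-/(_ Sx Sx) ?; apply/seteqP; split=> //.
  exact: cube_sub.
rewrite /parent filtration_atoms_filtr; apply/seteqP; split=> t.
  move=> [_]; apply; split; first by exists x, j.
  split; last by move=> /(ae_eq _ (ltW jk)).
  apply: negligibleS (@negligible_set0 _ _ _ mu) => u [ku]; apply; apply: sub_piece.
  split; first exact/ckj/piece_sub.
  exact: piece_notN ku nS.
move=> pt; split; first by have [] := piece_sub pt.
move=> A [[y [i [Sy Ny Gi ->]]] [QA nAQ]].
have ci := piece_ae_sub_cube Sx Sy QA.
have xi : lab i y = lab i x by case: (ci x).
rewrite xi in nAQ ci *.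
have ik : i < k.
  rewrite ltNge; apply/negP => ki; apply: nAQ.
  apply: negligibleS negligible_N => u [/piece_sub ui nuk].
  apply: contrapT => Nu; apply: nuk; apply: sub_piece; split=> //.
  by move: ui; apply: cube_sub.
have ij : i <= j.
  rewrite leNgt; apply/negP => ji; apply: nAQ.
  apply: negligibleS negligible_N => u [/piece_sub ui nuk].
  apply: contrapT => Nu; apply: nuk; apply: sub_piece; split=> //.
  by rewrite -(jmax i ji ik)// /lab_good -xi.
have cji : cube_at j (lab j x) `<=` cube_at i (lab i x) by apply: cube_sub.
rewrite {1}/piece; case: asboolP => [_|ni]; first by have [] := piece_sub pt.
split; first exact/cji/piece_sub.
apply: piece_notN pt _ => e; apply: ni; apply/seteqP; split=> [u []//|].
by rewrite -e.
Qed.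

(** * The kernel integral between an atom and its parent *)

Local Notation I := (kernel_integral (n := n) mu).

Definition dilate (a : R) k x : set (Rd R d) :=
  eucl_ball (lab k x) (a * lab_rad k x).

Let measurable_dilateD a b k j x : measurable (dilate a k x `\` dilate b j x).
Proof. by apply: measurableD; exact: measurable_eucl_ball. Qed.

Lemma powR_divN (a b c : R) : 0 < b -> 0 <= a -> a <= c * b -> a `^ n * b `^ (- n) <= c `^ n.
Proof.
move=> b0 a0 ab; have bn : 0 < b `^ n by rewrite powR_gt0.
have c0 : 0 <= c by rewrite -(pmulr_lge0 _ b0); exact: le_trans ab.
rewrite powRN ler_pdivrMr// -powRM ?(ltW b0)//.
by apply: ge0_ler_powR ab; rewrite ?nnegrE ?(ltW n_gt0)// mulr_ge0// ltW.
Qed.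

(** With t = j + s, the mass of the larger ball is at most rho(j-1)^n / beta^s, and on the support
    outside the smaller one the kernel is at most rho(t+1)^(-n). The scales contribute
    ratio^(n(s+2)), and beta^s absorbs all but ratio^(2n) while leaving a factor 2^(-s). *)
Lemma annulus_le j (s : nat) x : supp mu x ->
  (forall i, j < i -> i <= j + s%:Z -> ~ lab_good i x) ->
  (I x (dilate 200 (j + s%:Z) x `\` dilate 200 (j + s%:Z + 1) x) <=
    ((ratio `^ n) ^+ 2 / 2 ^+ s)%:E)%E.
Proof.
move=> Sx bad; set t := j + s%:Z.
have rt0 := rho_gt0 (R := R) (t + 1).
have rn0 : 0 < (ratio : R) `^ n by rewrite powR_gt0// ratio_gt0.
apply: le_trans (kernel_integral_le mu_growth n_gt0 (c := rho (t + 1)) (w := lab t x)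
  (s := 200 * lab_rad t x) null_setC_supp _ rt0 _ _) _ => //.
  move=> y [_ /negP]; rewrite -leNgt => ty _.
  have := lab_dist (t + 1) Sx; have := eucl_dist_triangle x (lab (t + 1) x) y.
  rewrite (eucl_distC (lab (t + 1) x) x) -/(lab_rad (t + 1) x).
  by have := lab_rad_ge (t + 1) x; lra.
rewrite lee_fin -/(lab_mass t x).
have b0 := beta_gt0.
have h1 := lab_mass_decay_iter Sx bad.
have h2 := lab_mass_le j x.
have m0 := lab_mass_gt0 t Sx.
have bs : (2 * ratio `^ n) ^+ s <= beta ^+ s.
  by apply: lerXn2r beta_n; rewrite ?nnegrE ?(ltW b0)// mulr_ge0// ltW.
have h3 : 2 ^+ s * (ratio `^ n) ^+ s * lab_mass t x <= rho (j - 1) `^ n.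
  apply: le_trans h2; apply: le_trans h1; rewrite -exprMn.
  by rewrite ler_wpM2r// ltW.
have h4 : rho (j - 1) `^ n * rho (t + 1) `^ (- n) = (ratio `^ n) ^+ 2 * (ratio `^ n) ^+ s.
  have -> : rho (j - 1) = rho (t + 1) * ratio ^+ (s.+2) :> R.
    by rewrite -rho_sub /t; congr rho; lia.
  rewrite powRM ?exprn_ge0 ?(ltW rt0) ?(ltW ratio_gt0)// powRN mulrAC divff.
    rewrite mul1r -exprD -powR_mulrn ?(ltW ratio_gt0)// -powRrM (mulrC _ n).
    by rewrite powRrM powR_mulrn ?powR_ge0.
  by rewrite gt_eqF// powR_gt0.
have rs0 : 0 < (ratio `^ n) ^+ s :> R by rewrite exprn_gt0.
rewrite ler_pdivlMr ?exprn_gt0// -(ler_pM2r rs0) -h4.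
rewrite [leLHS](_ : _ = (2 ^+ s * (ratio `^ n) ^+ s * lab_mass t x) * rho (t + 1) `^ (- n)).
  by rewrite ler_wpM2r// powR_ge0.
by ring.
Qed.

(** Sum of the annuli, with the exact partial sum of the geometric series as induction hypothesis.
    The end level j + s may be good: the last annulus starts from level j + s - 1. *)
Lemma chain_le j (s : nat) x : supp mu x ->
  (forall i, j < i -> i < j + s%:Z -> ~ lab_good i x) ->
  (I x (dilate 200 j x `\` dilate 200 (j + s%:Z) x) <=
    (2 * (ratio `^ n) ^+ 2)%:E)%E.
Proof.
move=> Sx bad.
apply: (@le_trans _ _ (2 * (ratio `^ n) ^+ 2 * (1 - 1 / 2 ^+ s))%:E).
  elim: s bad => [|s ih] bad.
    by rewrite addr0 setDv /kernel_integral integral_set0 lee_fin expr0 divr1 subrr mulr0.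
  have bad' i : j < i -> i < j + s%:Z -> ~ lab_good i x.
    by move=> h1 h2; apply: bad => //; lia.
  have {ih}h1 := ih bad'.
  have h2 : (I x (dilate 200 (j + s%:Z) x `\` dilate 200 (j + s%:Z + 1) x) <=
    ((ratio `^ n) ^+ 2 / 2 ^+ s)%:E)%E.
    by apply: annulus_le => // i h2 h3; apply: bad => //; lia.
  rewrite (_ : j + s.+1%:Z = j + s%:Z + 1); last by lia.
  apply: le_trans (kernel_integral_cover _ _ _ _ h1 h2) _ => //.
    move=> y [jy ny]; have [|] := pselect (dilate 200 (j + s%:Z) x y); [right|left] => //.
  rewrite lee_fin le_eqVlt; apply/orP; left; apply/eqP.
  have : 2 ^+ s != 0 :> R by rewrite expf_neq0.
  rewrite (exprS 2 s); move: (2 ^+ s) ((ratio `^ n) ^+ 2) => p q p0.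
  by field.
by rewrite lee_fin ler_piMr ?mulr_ge0 ?exprn_ge0 ?powR_ge0//.
Qed.

(* The support does not meet the part of the ball of level [i] outside
   [6 B_k], as both balls are comparable with the same cube. *)
Lemma same_cube_le i k x : supp mu x -> i <= k ->
  cube_at i (lab i x) = cube_at k (lab k x) ->
  (I x (dilate 200 i x `\` dilate 56 k x) <= (ratio `^ n)%:E)%E.
Proof.
move=> Sx ik eqc.
have ri0 := lab_rad_gt0 i x.
have ri20 : 0 < lab_rad i x / 2 by rewrite divr_gt0.
have Zi := lab_Z i Sx.
have xk := lab_dist k Sx; rewrite -/(lab_rad k x) in xk.
apply: le_trans (kernel_integral_le mu_growth n_gt0 (c := lab_rad i x / 2) (w := lab i x)
  (s := 200 * lab_rad i x) null_setC_supp _ ri20 _ _) _ => //.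
  move=> y [_ /negP]; rewrite -leNgt => ky Sy.
  have := eucl_dist_triangle x (lab k x) y; rewrite (eucl_distC (lab k x) x).
  have [eik|ik'] := eqVneq i k; first by rewrite -eik in ky xk *; lra.
  have {ik'}ik : i < k by rewrite lt_neqAle ik'.
  (* Both [x] and the center of level [i] are within [6 * lab_rad k x] of the center of level [k],
     and that radius is at most [rho i / 200]. So a point at distance at least [lab_rad i x] from
     the center of level [i] is at least half as far from [x]. *)
  have ci : cube_at k (lab k x) (lab i x).
    rewrite -eqc; split; first exact: ZS Zi.
    by apply: lab_ball => //; [exact: ZS Zi|rewrite eucl_distxx].
  have cd : eucl_dist (lab i x) (lab k x) < 6 * lab_rad k x.
    by rewrite /lab_rad; move: ci => [Sl <-]; exact: lab_dist.
  have yi : lab_rad i x <= eucl_dist y (lab i x).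
    rewrite leNgt; apply/negP => yi.
    have : cube_at i (lab i x) y by split=> //; exact: lab_ball.
    rewrite eqc => -[_ yk]; have := lab_dist k Sy; rewrite yk -/(lab_rad k x).
    by rewrite eucl_distC; have := lab_rad_gt0 k x; lra.
  have rk := lab_rad_le k x.
  have rr : rho k <= rho (i + 1) :> R by apply: le_rho; lia.
  have := rhoS (R := R) i; have := lab_rad_ge i x.
  have := eucl_dist_triangle x y (lab i x); have := eucl_dist_triangle (lab k x) x (lab i x).
  rewrite (eucl_distC y x) (eucl_distC (lab k x) (lab i x)).
  have := rho_gt0 (R := R) k.
  by lra.
rewrite lee_fin.
apply: (@le_trans _ _ ((200 * lab_rad i x) `^ n * (lab_rad i x / 2) `^ (- n))).
  by rewrite ler_wpM2r ?powR_ge0// (mass_le mu_growth)//; lra.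
by apply: powR_divN => //; rewrite ?ratioE; lra.
Qed.

(** Covers the case where the ball chosen for the parent comes from a finer level [i]: its mass is
    at most rho(k-1)^n, while points outside the ball of level [k] dilated by 56 are at distance at
    least [rho k] from [x]. *)
Lemma finer_le i k x : supp mu x -> k <= i ->
  (I x (dilate 200 i x `\` dilate 56 k x) <= (ratio `^ n)%:E)%E.
Proof.
move=> Sx ki; have rk0 := rho_gt0 (R := R) k.
apply: le_trans (kernel_integral_le mu_growth n_gt0 (c := rho k) (w := lab i x)
  (s := 200 * lab_rad i x) null_setC_supp _ rk0 _ _) _ => //.
  move=> y [_ /negP]; rewrite -leNgt => ky _.
  have := lab_dist k Sx; have := eucl_dist_triangle x (lab k x) y.
  rewrite (eucl_distC (lab k x) x) -/(lab_rad k x).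
  by have := lab_rad_ge k x; lra.
rewrite lee_fin -/(lab_mass i x).
apply: (@le_trans _ _ (rho (i - 1) `^ n * rho k `^ (- n))).
  by rewrite ler_wpM2r ?powR_ge0// lab_mass_le.
apply: powR_divN => //; first exact: ltW (rho_gt0 _).
apply: (@le_trans _ _ (rho (k - 1))); first by apply: le_rho; lia.
by rewrite rho_ratio subrK.
Qed.

(** Levels [l] and [j] describe the parent, levels [i] and [k] the atom, and no level strictly
    between [j] and [i] is good. Cutting at [j] and [i] leaves two passages between levels with the
    same cube and one chain. *)
Lemma nested_cubes_le i j k l x : supp mu x -> j < i -> i <= k ->
  (forall t, j < t -> t < i -> ~ lab_good t x) ->
  cube_at i (lab i x) = cube_at k (lab k x) ->
  cube_at l (lab l x) = cube_at j (lab j x) ->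
  (I x (dilate 200 l x `\` dilate 56 k x) <=
    (ratio `^ n + (2 * (ratio `^ n) ^+ 2 + ratio `^ n))%:E)%E.
Proof.
move=> Sx ji ik bad eqi eql.
have h1 : (I x (dilate 200 l x `\` dilate 56 j x) <= (ratio `^ n)%:E)%E.
  by have [lj|/ltW jl] := leP l j; [exact: same_cube_le|exact: finer_le].
have h3 := same_cube_le Sx ik eqi.
have ei : i = j + (`|i - j|%N)%:Z by lia.
have h2 : (I x (dilate 200 j x `\` dilate 200 i x) <= (2 * (ratio `^ n) ^+ 2)%:E)%E.
  by rewrite ei; apply: chain_le => // t jt ti; apply: bad => //; lia.
have h23 := kernel_integral_cover (measurable_dilateD 200 56 j k x)
  (measurable_dilateD _ _ _ _ _) (measurable_dilateD _ _ _ _ _) _ h2 h3.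
apply: (kernel_integral_cover _ _ _ _ h1 (h23 _)) => //.
- move=> y [ly ky]; have [jy|jy] := pselect (dilate 56 j x y); [right|left] => //.
  split=> //; move: jy; rewrite /dilate /eucl_ball/=.
  by have := lab_rad_gt0 j x; lra.
- by move=> y [jy ky]; have [|] := pselect (dilate 200 i x y); [right|left].
Qed.

(** * Weak-* density for the filtration *)

Lemma le_filtr j k : j <= k -> filtr j `<=` filtr k.
Proof.
move=> jk; have -> : k = j + (`|k - j|%N)%:Z by lia.
elim: `|k - j|%N => [|s ih]; first by rewrite addr0.
rewrite (_ : j + s.+1%:Z = j + s%:Z + 1); last by lia.
by apply: subset_trans ih _; exact: filtr_nested.
Qed.

(** Take the union of the atoms of [filtr k] that meet [K]. Two points of such an atom are less than
    [12 * (200 * rho k)] apart, so outside [N] a point at positive distance from [K] eventually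
    leaves this union. *)
Lemma closed_approximable (g : Rd R d -> R) (K : set (Rd R d)) :
  mu.-integrable setT (EFin \o g) -> (forall x, 0 <= g x) ->
  closed (K : set 'rV[R]_d) -> approximable mu (supp mu) filtr g K.
Proof.
move=> ig g0 cK.
pose U (k : nat) : set (Rd R d) :=
  \bigcup_(A in maximal_pieces k%:Z `&` [set A | A `&` K !=set0]) A.
apply: (@approximable_cvg _ _ _ _ _ _ _ _ _ _ _ _ U) => //.
- by move=> k; case: (filtr_sub_sigma_algebra k).
- exact: closed_measurable_Rd.
- by move=> k; apply: filtr_bigcup => A [].
apply: negligibleS negligible_N => x h; apply: contrapT => Nx; apply: h => Sx.
have [Kx|nKx] := pselect (K x).
  exists 0%N => k _; split=> // _.
  have [A mA Ax] := maximal_pieces_cover k%:Z Sx Nx.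
  by exists A => //; split=> //; exists x.
have [e e0 eK] : exists2 e, 0 < e & eucl_ball x e `<=` ~` K.
  by have /open_euclP := closed_openC cK; apply.
have [M hM] : exists M : int, forall m, M <= m -> rho m < e / 12 / 200.
  by apply: rho_small; lra.
exists `|M|%N => k Mk; split=> // -[A [[u [j [Su Nu [kj _ _] ->]]] [y [Ay Ky]]] Ax].
exfalso; apply: (eK y) => //.
have /hM rj : M <= j by lia.
have := cube_dist (piece_sub Ax); have := cube_dist (piece_sub Ay).
have := rad_le good_ball j (lab j u); have := eucl_dist_triangle (lab j u) x y.
by rewrite /eucl_ball/= (eucl_distC (lab j u) y); lra.
Qed.

Lemma dense_Linf_filtr : dense (\bigcup_(k : int) Linf_sub mu (filtr k)).
Proof.
apply: dense_Linf_sub => //.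
- exact: filtr_sub_sigma_algebra.
- exact: le_filtr.
move=> g ig g0; apply: smallest_sub.
  apply: approximable_sigma_algebra => //.
  + by move=> k; case: (filtr_sub_sigma_algebra k).
  + by move=> k; case: (filtr_sub_sigma_algebra k).
  + exact: le_filtr.
move=> U oU; rewrite -[U]setCK; apply: approximableC.
  by move=> k; case: (filtr_sub_sigma_algebra k).
by apply: closed_approximable => //; exact: open_closedC.
Qed.

Lemma ae_subset_of_subset (A B : set (Rd R d)) : A `<=` B -> ae_subset mu A B.
Proof. by rewrite /ae_subset -setD_eq0 => ->; exact: negligible_set0. Qed.

Lemma piece_inj j k x y : supp mu x -> supp mu y ->
  piece j (lab j x) = piece k (lab k y) ->
  cube_at j (lab j x) = cube_at k (lab k y).
Proof.
move=> Sx Sy e; apply/seteqP; split.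
- by apply: piece_ae_sub_cube => //; apply: ae_subset_of_subset; rewrite e.
- by apply: piece_ae_sub_cube => //; apply: ae_subset_of_subset; rewrite e.
Qed.

Lemma lab_doubling k x : lab_good k x ->
  doubling mu 200 beta (lab k x) (lab_rad k x).
Proof.
move=> gk; rewrite /doubling /lab_rad rad_good// !(massE mu_growth) -EFinM lee_fin.
exact: gk.
Qed.

(** [z] and [r] depend on the set alone, so a level and a point representing each atom are fixed by
    choice; [zrE] trades that point for any point of the atom. The level chosen for a parent need
    not be the one given by [parent_piece], but it has the same cube. *)
Lemma filtr_inner_balls :
  exists (z : set (Rd R d) -> 'rV[R]_d) (r : set (Rd R d) -> R),
    (forall Q, filtration_atoms mu filtr Q ->
       [/\ 0 < r Q, doubling mu 200 beta (z Q) (r Q),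
           ae_subset mu (eucl_ball (z Q) (r Q)) Q
         & ae_subset mu Q (eucl_ball (z Q) (28 * r Q))]) /\
    (forall (Q : set (Rd R d)) x, filtration_atoms mu filtr Q -> Q x ->
       let P := parent mu filtr Q in
       filtration_atoms mu filtr P /\
       (\int[mu]_(y in eucl_ball (z P) (200 * r P) `\` eucl_ball (z Q) (56 * r Q))
          ((eucl_dist x y `^ n)%:E)^-1 <=
        (ratio `^ n + (2 * (ratio `^ n) ^+ 2 + ratio `^ n))%:E)%E).
Proof.
have rep0 (Q : set (Rd R d)) : exists p : int * 'rV[R]_d, good_pieces Q ->
    [/\ supp mu p.2, ~ N p.2, lab_good p.1 p.2 & Q = piece p.1 (lab p.1 p.2)].
  have [[x [j hx]]|nQ] := pselect (good_pieces Q); last by exists (0, 0).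
  by exists (j, x).
have [rep hrep] := choice rep0.
pose z Q := lab (rep Q).1 (rep Q).2; pose r Q := lab_rad (rep Q).1 (rep Q).2.
have zrE Q x : good_pieces Q -> Q x -> supp mu x /\ exists k,
    [/\ lab_good k x, Q = piece k (lab k x), z Q = lab k x & r Q = lab_rad k x].
  move=> gQ; have [S0 N0' G0 QE] := hrep _ gQ.
  rewrite {1}QE => /piece_sub[Sx x0]; split=> //; exists (rep Q).1.
  by rewrite /lab_good /lab_rad /z /r x0; split.
exists z, r; rewrite filtration_atoms_filtr; split=> [Q gQ|Q x gQ Qx P].
  have [S0 N0' G0 QE] := hrep _ gQ.
  split; [exact: lab_rad_gt0|exact: lab_doubling| |].
  - by rewrite {3}QE; apply: ball_ae_sub_piece; exact: lab_Z.
  - apply: ae_subset_of_subset => y; rewrite {1}QE => /piece_sub/cube_dist.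
    rewrite /eucl_ball/= eucl_distC /z /r /lab_rad.
    by have := rad_gt0 good_ball (rep Q).1 (lab (rep Q).1 (rep Q).2); lra.
have [Sx [k [Gk QE zQ rQ]]] := zrE _ _ gQ Qx.
have rk := lab_rad_gt0 k x.
have xk : eucl_dist x (lab k x) < 56 * lab_rad k x.
  by have := lab_dist k Sx; rewrite /lab_rad in rk *; lra.
rewrite zQ rQ (kernel_integralE mu xk); last by move=> y [].
have rn0 : 0 <= (ratio : R) `^ n by exact: powR_ge0.
(* If the atom is the whole support, it is its own parent, and the integral runs between two
   dilations of one ball. *)
have [cS|nS] := pselect (cube_at k (lab k x) = supp mu).
  have QS : Q = supp mu by rewrite QE /piece asboolT.
  have PQ : P = Q by rewrite /P (parent_supp gQ QS) QS.
  rewrite PQ zQ rQ; split=> //.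
  have h : (kernel_integral (n := n) mu x (dilate 200 k x `\` dilate 56 k x) <= (ratio `^ n)%:E)%E.
    exact: same_cube_le.
  by apply: le_trans h _; rewrite lee_fin lerDl addr_ge0// mulr_ge0// exprn_ge0.
have Nx : ~ N x by move: Qx; rewrite QE => /piece_notN; apply.
have [j [jk Gj PE jmax]] := parent_piece Sx Nx Gk nS.
rewrite -QE -/P in PE.
have gP : good_pieces P by exists x, j.
have Px : P x by rewrite PE; exact: piece_mem.
have [_ [l [Gl PE' zP rP]]] := zrE _ _ gP Px.
split=> //; rewrite zP rP.
(* The first good level after [j] may come before [k]; by the choice of [j] it then has the same
   cube as [k]. *)
have [i [ji Gi fi]] := first_good_exists (j + 1) Sx Nx.
have ik : i <= k.
  by rewrite leNgt; apply/negP => ki; apply: (fi k) => //; lia.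
apply: (@nested_cubes_le i j k l) => //.
- lia.
- by move=> t jt ti; apply: fi => //; lia.
- have [->//|ni] := eqVneq i k; apply: jmax => //; first by lia.
  by rewrite lt_neqAle ni.
- by apply: piece_inj => //; rewrite -PE.
Qed.

End lattice.

Theorem theoremA (R : realType) (d : nat) (n : R) (n_gt0 : 0 < n) :
  exists C : R -> R -> R,
  forall mu : {measure set (Rd R d) -> \bar R},
  radon mu -> polynomial_growth mu n ->
  exists alpha beta : R, 100 < alpha /\ 100 < beta /\
  exists Sigma : int -> set (set (Rd R d)),
    (forall k : int,
       sub_sigma_algebra_supp mu (Sigma k) /\ atomic mu (Sigma k)) /\
    (* (i) *)
    (forall k : int, Sigma k `<=` Sigma (k + 1)) /\
    (* (ii) *)
    dense (\bigcup_(k : int) Linf_sub mu (Sigma k)) /\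
    (* [eucl_ball (z Q) (r Q)] is the ball B_Q *)
    exists (z : set (Rd R d) -> 'rV[R]_d) (r : set (Rd R d) -> R),
      (* (iii) *)
      (forall Q, filtration_atoms mu Sigma Q ->
         [/\ 0 < r Q,
             doubling mu alpha beta (z Q) (r Q),
             ae_subset mu (eucl_ball (z Q) (r Q)) Q
           & ae_subset mu Q (eucl_ball (z Q) (28 * r Q))]) /\
      (* (iv) *)
      (forall (Q : set (Rd R d)) (x : 'rV[R]_d),
         filtration_atoms mu Sigma Q -> Q x ->
         let P := parent mu Sigma Q in
         filtration_atoms mu Sigma P /\
         (\int[mu]_(y in eucl_ball (z P) (alpha * r P) `\` eucl_ball (z Q) (56 * r Q))
            ((eucl_dist x y `^ n)%:E)^-1 <= (C alpha beta)%:E)%E).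
Proof.
(* The three terms bound the passage within the parent, the chain, and the passage within the atom;
   they involve [n] only. *)
exists (fun _ _ => ratio `^ n + (2 * (ratio `^ n) ^+ 2 + ratio `^ n)).
move=> mu _ mu_growth.
have rn0 : 0 <= (ratio : R) `^ n by exact: powR_ge0.
have rd0 : 0 <= (ratio : R) ^+ d by rewrite exprn_ge0// ltW// ratio_gt0.
(* The term 101 secures the lower bound 100; the others give the bounds against growth and against
   dimension. *)
pose beta : R := 101 + 2 * ratio `^ n + 2 * ratio ^+ d.
have beta_n : 2 * ratio `^ n <= beta by rewrite /beta; lra.
have beta_d : 2 * ratio ^+ d <= beta by rewrite /beta; lra.
have [Z [lab [hZ hlab lab_ball lab_step [lab_nest mcube]]]] :=
  exists_labels (good_ball mu beta) (measurable_supp mu_growth).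
have ZS k : Z k `<=` supp mu by case: (hZ k).
have countZ k : countable (Z k) by case: (hZ k).
have lab_Z k x : supp mu x -> Z k (lab k x) by move=> /(hlab k)[].
have lab_dist k x : supp mu x ->
    eucl_dist x (lab k x) < 6 * rad (good_ball mu beta) k (lab k x).
  by move=> /(hlab k)[].
have [N [mN N0 _ good_below]] :=
  exists_null_not_good mu_growth n_gt0 beta_n beta_d lab_dist lab_step.
exists 200, beta; split; first by lra.
split; first by rewrite /beta; lra.
exists (filtr mu beta lab N); split=> [k|].
  split; first exact: (filtr_sub_sigma_algebra mu_growth beta mcube mN k).
  exact: (filtr_atomic mu_growth n_gt0 beta_n beta_d ZS).
split.
  exact: (filtr_nested n_gt0 beta_n beta_d lab_Z countZ lab_nest good_below).
split.
  exact: (dense_Linf_filtr mu_growth n_gt0 beta_n beta_d lab_Z lab_dist countZ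
    lab_nest mcube mN N0 good_below).
exact: (filtr_inner_balls mu_growth n_gt0 beta_n beta_d ZS lab_Z lab_dist).
Qed.
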